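(* Let $A\in\mathscr{D}\mathrm{iag}$ with $L(A)>0$. There exist a neighborhood $\mathscr{N}_A$ of $A$ in $\mathrm{SL}_2(\mathbb{R})^k$ (on which $\rho_-$ is defined) and a constant $c=c(A)>0$ such that for every $B\in\mathscr{N}_A$ with $\rho_-(B)>0$, $$\mathbb{P}\Big[\Big|\tfrac1n\log\|B^{(n)}\|-L(B)\Big|>n^{-1/6}\Big]<e^{-n^{1/6}}$$ for all $n\ge\big[c^{-1}\log\rho_-(B)^{-1}\big]^{54}$.
   Context: $\mathrm{SL}_2(\mathbb{R})$ denotes real $2\times2$ matrices with determinant $\pm1$. $\Sigma=\{1,\dots,k\}$, $p$ a probability vector with positive entries, $X=\Sigma^{\mathbb{Z}}$, $\mathbb{P}=p^{\mathbb{Z}}$; a cocycle $B=(B_1,\dots,B_k)$ has iterates $B^{(n)}(x)=B_{x_{n-1}}\cdots B_{x_0}$ and Lyapunov exponent $L(B)$ (a.s. limit of $\frac1n\log\|B^{(n)}(x)\|$). $\mathscr{D}\mathrm{iag}$ is the set of cocycles with two transversal lines invariant under all matrices. Projective metric $d(\hat p,\hat q)=|\sin\angle(p,q)|$, $\hat g$ the projective action. For $A\in\mathscr{D}\mathrm{iag}$ with $L(A)>0$: $e_\pm(A)$ unit vectors spanning the invariant lines with restricted exponent $\pm L(A)$, $A_je_+(A)=a_je_+(A)$, $\Sigma_H(A)=\{i:|a_i|\ge e^{L(A)}\}$. For a hyperbolic matrix $g$ (real eigenvalues of modulus $>1$ and $<1$), $\hat e_-(g)$ is its contracting eigendirection.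 For $B$ with $B_i$ hyperbolic for all $i\in\Sigma_H(A)$: $\rho_-(B)=\max_{i\in\Sigma_H(A)}\max_{1\le j\le k}d(\hat B_j\hat e_-(B_i),\hat e_-(B_i))$. *)

(* Defs.v *)
From HB Require Import structures.
From mathcomp Require Import all_boot all_order all_algebra.
From mathcomp Require Import all_classical all_reals all_analysis.
From mathcomp Require Import Rstruct Rstruct_topology.
Set Implicit Arguments. Unset Strict Implicit. Unset Printing Implicit Defensive.
Import Order.TTheory GRing.Theory Num.Theory.
Local Open Scope classical_set_scope.
Local Open Scope ring_scope.

Notation RR := Rdefinitions.R.

Definition cocycle (k : nat) := 'I_k -> 'M[RR]_2.

(* SL_2(R) in the paper's convention: determinant +1 or -1 *)
Definition inSL (g : 'M[RR]_2) : Prop := \det g = 1 \/ \det g = -1.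

Definition prob_vec (k : nat) (p : 'I_k -> RR) : Prop :=
  (forall i, 0 < p i) /\ \sum_(i < k) p i = 1.

Definition vnorm (v : 'cV[RR]_2) : RR := Num.sqrt (v 0 0 ^+ 2 + v 1 0 ^+ 2).
Definition opnorm (g : 'M[RR]_2) : RR :=
  sup [set vnorm (g *m v) | v in [set v : 'cV[RR]_2 | vnorm v = 1]].

Definition iterate k (B : cocycle k) (w : seq 'I_k) : 'M[RR]_2 :=
  foldl (fun M i => B i *m M) 1%:M w.

Definition weight k (p : 'I_k -> RR) (w : seq 'I_k) : RR := \prod_(i <- w) p i.

(* probability (under p^Z) of an event depending on x_0..x_{n-1} only *)
Definition probn k (p : 'I_k -> RR) (n : nat) (E : n.-tuple 'I_k -> bool) : RR :=
  \sum_(w : n.-tuple 'I_k | E w) weight p w.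

Definition Elog k (p : 'I_k -> RR) (B : cocycle k) (n : nat) : RR :=
  \sum_(w : n.-tuple 'I_k) weight p w * ln (opnorm (iterate B w)).

Definition lyap k (p : 'I_k -> RR) (B : cocycle k) : RR :=
  limn (fun n : nat => (n.+1%:R)^-1 * Elog p B n.+1).

Definition invariant_line k (A : cocycle k) (u : 'cV[RR]_2) : Prop :=
  u != 0 /\ forall j, exists a : RR, A j *m u = a *: u.
Definition inDiag k (A : cocycle k) : Prop :=
  exists u v : 'cV[RR]_2, invariant_line A u /\ invariant_line A v /\
    u 0 0 * v 1 0 - u 1 0 * v 0 0 != 0.

(* e is a vector spanning the invariant line with restricted exponent L(A),
   with A_j e = a_j e *)
Definition eplus k (p : 'I_k -> RR) (A : cocycle k) (e : 'cV[RR]_2) (a : 'I_k -> RR) : Prop :=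
  e != 0 /\ (forall j, A j *m e = a j *: e) /\
  \sum_(j < k) p j * ln `|a j| = lyap p A.

Definition SigmaH k (p : 'I_k -> RR) (A : cocycle k) (i : 'I_k) : Prop :=
  exists e a, eplus p A e a /\ expR (lyap p A) <= `|a i|.

Definition eigvec (g : 'M[RR]_2) (l : RR) (v : 'cV[RR]_2) : Prop :=
  v != 0 /\ g *m v = l *: v.

Definition hyperbolic (g : 'M[RR]_2) : Prop :=
  exists l m : RR, 1 < `|l| /\ `|m| < 1 /\
    (exists v, eigvec g l v) /\ (exists v, eigvec g m v).

Definition contr_dir (g : 'M[RR]_2) (v : 'cV[RR]_2) : Prop :=
  exists m : RR, `|m| < 1 /\ eigvec g m v.
Definition eminus (g : 'M[RR]_2) : 'cV[RR]_2 := xget 0 [set v | contr_dir g v].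

(* projective distance d(\hat u, \hat v) = |sin angle(u, v)| *)
Definition pdist (u v : 'cV[RR]_2) : RR :=
  `|u 0 0 * v 1 0 - u 1 0 * v 0 0| / (vnorm u * vnorm v).

Definition rho_minus k (p : 'I_k -> RR) (A B : cocycle k) : RR :=
  \big[Num.max/0]_(i < k | `[< SigmaH p A i >])
    \big[Num.max/0]_(j < k) pdist (B j *m eminus (B i)) (eminus (B i)).

(* Main.v *)
Require Import Defs.
From HB Require Import structures.
From mathcomp Require Import all_boot all_order all_algebra.
From mathcomp Require Import all_classical all_reals all_analysis.
From mathcomp Require Import Rstruct Rstruct_topology.
From mathcomp Require Import exp ring lra.
Set Implicit Arguments. Unset Strict Implicit. Unset Printing Implicit Defensive.
Import Order.TTheory GRing.Theory Num.Theory.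
Local Open Scope ring_scope.

(** A random product whose growth [E log |B^(m) v| >= log |v| + 1] holds for every
    direction [v] at some common time [m] satisfies a large deviation estimate with
    constants polynomial in [m]: for small [s] the negative moments [E |B^(n) v|^-s] decay
    geometrically, and since [|B^(n) v /\ B^(n) w| = |v /\ w|] this makes the projective
    orbits of [v] and [w] contract in mean, so that [E log |B^(n) v|] depends on the
    direction only up to a bounded error [D = O(m^3)]. Then [log |B^(n) v|] minus its mean
    is a martingale with increments [O(D)], and [E log |B^(n) v| = n L(B) + O(D)].

    It remains to see that [m = O(log (1 / rho))]. In the basis [e_+(A), e_-(B_i)], with
    [i] attaining [rho = rho_-(B)], the entries moving [e_-(B_i)] off its line are [O(rho)],
    vanish for [B_i], and one of them is comparable to [rho]. Rescaling the second
    coordinate by a multiple of [rho] turns them into entries of order one, while the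
    opposite entries become negligible. In these coordinates the growth constants depend
    on [A] only: outside the cone [|x| < |y|] the coordinate [x] grows at a rate close to
    [L(A)], and inside it a fixed word (a letter moving [e_-(B_i)], then many [i]'s) leads
    out of the cone with a definite probability. Undoing the rescaling costs
    [log (1 / rho)]. *)

(** * Expectations over words *)

(** From [1 - x <= exp (- x)] the exponential is at most [1 / (1 - x)], and [(1 + x + 2 x^2) (1 - x)
    = 1 + x^2 (1 - 2 x) >= 1]. The second-order estimates of exponential moments below rest on this
    bound. *)
Lemma expR_le_quad (x : RR) : x <= 2^-1 -> expR x <= 1 + x + 2 * x ^+ 2.
Proof.
move=> hx; have h1 : 1 - x <= expR (- x) by apply: expR_ge1Dx.
have h2 : expR x * expR (- x) = 1 by rewrite expRN divff// gt_eqF// expR_gt0.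
have e0 : 0 < expR x by exact: expR_gt0.
have h3 : expR x * (1 - x) <= 1 by rewrite -[leRHS]h2 ler_wpM2l// ltW.
have q : 0 <= x ^+ 2 * (1 - 2 * x) by rewrite mulr_ge0 ?sqr_ge0//; lra.
have p1 : 0 < 1 - x by lra.
rewrite -(ler_pM2r p1) (le_trans h3)//.
have -> : (1 + x + 2 * x ^+ 2) * (1 - x) = 1 + x ^+ 2 * (1 - 2 * x) by ring.
lra.
Qed.

Lemma fin_ubound (k : nat) (f : 'I_k -> RR) :
  exists2 C : RR, 1 <= C & forall i, `|f i| <= C.
Proof.
exists (1 + \sum_(i < k) `|f i|) => [|i]; first by rewrite lerDl sumr_ge0.
by rewrite (bigD1 i)//= addrCA lerDl addr_ge0// sumr_ge0.
Qed.

(** The recursion peels off the first letter and the integrand takes arbitrary sequences instead of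
    tuples, so that conditioning on a prefix ([Ex_cat]) needs no cast between lengths. [Ex_tupleE]
    leads back to sums over tuples. *)
Fixpoint Ex (k : nat) (p : 'I_k -> RR) (n : nat) (F : seq 'I_k -> RR) : RR :=
  if n is n'.+1 then \sum_(j < k) p j * Ex p n' (fun w => F (j :: w)) else F [::].

Section Expectation.
Variables (k : nat) (p : 'I_k -> RR).
Implicit Types F G : seq 'I_k -> RR.

Lemma Ex_tupleE n F : Ex p n F = \sum_(w : n.-tuple 'I_k) weight p w * F w.
Proof.
elim: n F => [|n IH] F /=.
  rewrite (eq_bigr (fun=> F [::])); first by rewrite sumr_const card_tuple expn0 mulr1n.
  by move=> w _; rewrite tuple0 /weight big_nil mul1r.
under eq_bigr do rewrite IH big_distrr/=.
rewrite pair_bigA /= (reindex (fun w : n.+1.-tuple 'I_k => (thead w, [tuple of behead w]))) /=.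
  by apply: eq_bigr => w _; case/tupleP: w => j w /=; rewrite theadE /weight big_cons mulrA.
exists (fun jw : 'I_k * n.-tuple 'I_k => [tuple of jw.1 :: jw.2]) => [w|[j w]] _ /=.
  by rewrite -tuple_eta.
by rewrite theadE; congr pair; apply/val_inj.
Qed.

Lemma eq_Ex n F G : (forall w, size w = n -> F w = G w) -> Ex p n F = Ex p n G.
Proof.
elim: n F G => [|n IH] F G h /=; first exact: h.
by apply: eq_bigr => j _; congr (_ * _); apply: IH => w sw; apply: h; rewrite /= sw.
Qed.

Lemma Ex_add n F G : Ex p n (fun w => F w + G w) = Ex p n F + Ex p n G.
Proof.
elim: n F G => [|n IH] F G //=.
by rewrite -big_split/=; apply: eq_bigr => j _; rewrite IH mulrDr.
Qed.

Lemma Ex_scale n c F : Ex p n (fun w => c * F w) = c * Ex p n F.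
Proof.
elim: n F => [|n IH] F //=.
by rewrite big_distrr/=; apply: eq_bigr => j _; rewrite IH mulrCA.
Qed.

Lemma Ex_opp n F : Ex p n (fun w => - F w) = - Ex p n F.
Proof. by rewrite -mulN1r -Ex_scale; apply: eq_Ex => w _; rewrite mulN1r. Qed.

Lemma Ex_sub n F G : Ex p n (fun w => F w - G w) = Ex p n F - Ex p n G.
Proof. by rewrite Ex_add Ex_opp. Qed.

Lemma Ex_cat m n F :
  Ex p (m + n) F = Ex p m (fun u => Ex p n (fun w => F (u ++ w))).
Proof. by elim: m F => [|m IH] F //=; apply: eq_bigr => j _; rewrite IH. Qed.

Lemma Ex_sum n (I : finType) (F : I -> seq 'I_k -> RR) :
  Ex p n (fun w => \sum_i F i w) = \sum_i Ex p n (F i).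
Proof.
elim: n F => [|n IH] F //=.
by rewrite exchange_big/=; apply: eq_bigr => j _; rewrite IH big_distrr.
Qed.

Hypothesis hp : prob_vec p.

Lemma Ex_const n c : Ex p n (fun=> c) = c.
Proof.
elim: n => [|n IH] //=; under eq_bigr do rewrite IH.
by rewrite -big_distrl/= hp.2 mul1r.
Qed.

Lemma le_Ex n F G : (forall w, size w = n -> F w <= G w) -> Ex p n F <= Ex p n G.
Proof.
elim: n F G => [|n IH] F G h /=; first exact: h.
apply: ler_sum => j _; apply: ler_wpM2l; first exact/ltW/hp.1.
by apply: IH => w sw; apply: h; rewrite /= sw.
Qed.

Lemma Ex_le n F c : (forall w, size w = n -> F w <= c) -> Ex p n F <= c.
Proof. by move=> h; rewrite -[leRHS](Ex_const n); exact: le_Ex. Qed.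

Lemma Ex_ge n F c : (forall w, size w = n -> c <= F w) -> c <= Ex p n F.
Proof. by move=> h; rewrite -[leLHS](Ex_const n); exact: le_Ex. Qed.

Lemma weight_gt0 w : 0 < weight p w.
Proof. by rewrite /weight; apply: prodr_gt0 => i _; exact: hp.1. Qed.

(** In the recursion every first letter other than that of [w] contributes at most its probability,
    and the saving [d] is carried along the single branch that follows [w]. The escape word below
    enters through this bound. *)
Lemma Ex_le1_word w F d : (forall u, size u = size w -> F u <= 1) ->
  F w <= 1 - d -> Ex p (size w) F <= 1 - weight p w * d.
Proof.
elim: w F d => [|j w IH] F d hF hw /=; first by rewrite /weight big_nil mul1r.
rewrite /weight big_cons -/(weight p w) -mulrA.
set x := weight p w * d.
have h1 : Ex p (size w) (fun u => F (j :: u)) <= 1 - x.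
  by apply: IH => // u su; apply: hF; rewrite /= su.
have -> : 1 - p j * x = (p j - p j * x) + \sum_(i < k | i != j) p i.
  by rewrite -hp.2 (bigD1 j)//= addrAC.
rewrite (bigD1 j)//= lerD//.
  by rewrite -{2}[p j]mulr1 -mulrBr ler_wpM2l// ltW// hp.1.
apply: ler_sum => i _; rewrite -[leRHS]mulr1.
apply: ler_wpM2l; first exact/ltW/hp.1.
by apply: Ex_le => u su; apply: hF; rewrite /= su.
Qed.

(** Markov's inequality for a majorant [F] of the indicator of [E]; later [F] is a sum of Chernoff
    exponentials. *)
Lemma probn_Ex n (E : n.-tuple 'I_k -> bool) F :
  (forall w, size w = n -> 0 <= F w) ->
  (forall w : n.-tuple 'I_k, E w -> 1 <= F w) -> probn p E <= Ex p n F.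
Proof.
move=> F0 F1; rewrite Ex_tupleE /probn big_mkcond/=; apply: ler_sum => w _.
have w0 := weight_gt0 w; case: ifPn => [/F1 h|_]; last first.
  by apply: mulr_ge0; [exact: ltW | apply: F0; rewrite size_tuple].
by rewrite -[leLHS]mulr1 ler_wpM2l// ltW.
Qed.

End Expectation.

(** * Norms and wedge products in the plane *)

Implicit Types v w : 'cV[RR]_2.

(** The maximum norm is used because it is read off directly on each of the cones [|y| <= |x|] and
    [|x| < |y|]. By [vnorm_ge] and [vnorm_le] it agrees with the Euclidean norm up to a factor 2. *)
Definition nm (v : 'cV[RR]_2) : RR := Num.max `|v 0 0| `|v 1 0|.

Definition wedge (v w : 'cV[RR]_2) : RR := v 0 0 * w 1 0 - v 1 0 * w 0 0.

Lemma mulmx2E (n : nat) (g : 'M[RR]_2) (h : 'M[RR]_(2, n)) r s :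
  (g *m h) r s = g r 0 * h 0 s + g r 1 * h 1 s.
Proof.
rewrite mxE !big_ord_recl big_ord0 addr0.
by have -> : lift ord0 ord0 = 1 :> 'I_2 by apply/val_inj.
Qed.

Lemma det2E (g : 'M[RR]_2) : \det g = g 0 0 * g 1 1 - g 0 1 * g 1 0.
Proof.
rewrite (expand_det_row _ 0) !big_ord_recl big_ord0 addr0 /cofactor !det_mx11 !mxE /=.
have e1 : lift ord0 ord0 = 1 :> 'I_2 by apply/val_inj.
have e0 : lift (1 : 'I_2) 0 = 0 :> 'I_2 by apply/val_inj.
by rewrite !e1 e0 /bump /= !addn0 expr0 expr1 mul1r mulN1r mulrN.
Qed.

Lemma ord2P (r : 'I_2) : r = 0 \/ r = 1.
Proof. by case: r => [[|[|]]]// i; [left|right]; apply/val_inj. Qed.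

Lemma eq_cV2 (v w : 'cV[RR]_2) : v 0 0 = w 0 0 -> v 1 0 = w 1 0 -> v = w.
Proof. by move=> h0 h1; apply/matrixP => r s; rewrite ord1; case: (ord2P r) => ->. Qed.

Lemma nm_le v c : (nm v <= c) = (`|v 0 0| <= c) && (`|v 1 0| <= c).
Proof. by rewrite /nm ge_max. Qed.

Lemma nm_coord v r : `|v r 0| <= nm v.
Proof. by rewrite /nm le_max; case: (ord2P r) => ->; rewrite lexx ?orbT. Qed.

Lemma nm_ge0 v : 0 <= nm v.
Proof. exact: le_trans (nm_coord v 0). Qed.

Lemma nm_gt0 v : v != 0 -> 0 < nm v.
Proof.
move=> v0; rewrite lt_neqAle nm_ge0 andbT; apply: contra v0 => /eqP h.
apply/eqP/eq_cV2; rewrite mxE; apply/eqP; rewrite -normr_le0 h; exact: nm_coord.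
Qed.

Lemma nm0P v : 0 < nm v -> v != 0.
Proof. by apply: contraTneq => ->; rewrite /nm !mxE normr0 maxxx ltxx. Qed.

Lemma nmZ c v : nm (c *: v) = `|c| * nm v.
Proof. by rewrite /nm !mxE !normrM maxr_pMr. Qed.

Lemma nmD v w : nm (v + w) <= nm v + nm w.
Proof.
rewrite nm_le !mxE; apply/andP; split; apply: (le_trans (ler_normD _ _));
  apply: lerD; exact: nm_coord.
Qed.

Lemma nm_mul_le (g : 'M[RR]_2) C v : (forall r s, `|g r s| <= C) ->
  nm (g *m v) <= 2 * C * nm v.
Proof.
move=> h; have e : 2 * C * nm v = C * nm v + C * nm v by ring.
rewrite nm_le !mulmx2E e; apply/andP; split; apply: (le_trans (ler_normD _ _));
  apply: lerD; rewrite normrM; apply: ler_pM => //; exact: nm_coord.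
Qed.

Lemma vnorm_ge v : nm v <= vnorm v.
Proof.
rewrite nm_le /vnorm -!sqrtr_sqr !ler_sqrt ?addr_ge0 ?sqr_ge0//.
by rewrite lerDl lerDr !sqr_ge0.
Qed.

Lemma vnorm_le v : vnorm v <= 2 * nm v.
Proof.
have n0 := nm_ge0 v.
have -> : 2 * nm v = Num.sqrt ((2 * nm v) ^+ 2) by rewrite sqrtr_sqr ger0_norm// mulr_ge0.
rewrite /vnorm ler_sqrt ?sqr_ge0//.
have h r : v r 0 ^+ 2 <= nm v ^+ 2.
  by rewrite -real_normK ?num_real// lerXn2r ?nnegrE ?nm_coord.
have := h 0; have := h 1; rewrite exprMn; have := sqr_ge0 (nm v); lra.
Qed.

Lemma wedge_mul (g : 'M[RR]_2) v w : wedge (g *m v) (g *m w) = \det g * wedge v w.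
Proof. by rewrite /wedge !mulmx2E det2E; ring. Qed.

Lemma wedge_le v w : `|wedge v w| <= 2 * (nm v * nm w).
Proof.
have e : 2 * (nm v * nm w) = nm v * nm w + nm v * nm w by ring.
rewrite e; apply: (le_trans (ler_normB _ _)); rewrite !normrM.
by apply: lerD; apply: ler_pM => //; apply: nm_coord.
Qed.

(** Choose [lam] so that [v] and [lam *: w] agree in the coordinate where [w] is largest. The
    difference then lives in the other coordinate, and its size times that largest coordinate is the
    wedge product. *)
Lemma nm_align v w : w != 0 -> exists lam : RR,
  `|lam| * nm w <= nm v /\ nm (v - lam *: w) * nm w = `|wedge v w|.
Proof.
move=> w0; have n0 := nm_gt0 w0.
case: (leP `|w 0 0| `|w 1 0|) => hw.
- have e : nm w = `|w 1 0| by rewrite /nm; apply/max_idPr.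
  have w1 : w 1 0 != 0 by rewrite -normr_gt0 -e.
  exists (v 1 0 / w 1 0); split.
    by rewrite e -normrM divfK// nm_coord.
  rewrite e /nm !mxE divfK// subrr normr0 (max_idPl _)// -normrM /wedge; congr `| _ |.
  by field.
- have e : nm w = `|w 0 0| by rewrite /nm; apply/max_idPl/ltW.
  have w1 : w 0 0 != 0 by rewrite -normr_gt0 -e.
  exists (v 0 0 / w 0 0); split.
    by rewrite e -normrM divfK// nm_coord.
  rewrite e /nm !mxE divfK// subrr normr0 (max_idPr _)// -normrM /wedge -normrN; congr `| _ |.
  by field.
Qed.

(** Reduces the operator norm to the images of the two basis vectors. The factor 4 is 2 for the
    change of norm times 2 for the two terms of a linear combination. *)
Lemma opnorm_bounds (g : 'M[RR]_2) :
  (forall s, nm (g *m delta_mx s 0) <= opnorm g) /\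
  opnorm g <= 4 * Num.max (nm (g *m delta_mx 0 0)) (nm (g *m delta_mx 1 0)).
Proof.
set M := Num.max _ _.
pose S := [set vnorm (g *m v) | v in [set v : 'cV[RR]_2 | vnorm v = 1]]%classic.
have ub : ubound S (4 * M).
  move=> _ [v /= v1 <-]; apply: (le_trans (vnorm_le _)).
  have -> : g *m v = v 0 0 *: (g *m delta_mx 0 0) + v 1 0 *: (g *m delta_mx 1 0).
    rewrite !scalemxAr -mulmxDr; congr (_ *m _).
    by apply: eq_cV2; rewrite !mxE /= !mulr1 !mulr0 ?addr0 ?add0r.
  have hv r : `|v r 0| <= 1 by rewrite -v1; apply: le_trans (vnorm_ge v); exact: nm_coord.
  have h s : `|v s 0| * nm (g *m delta_mx s 0) <= M.
    rewrite -[leRHS]mul1r; apply: ler_pM => //; first exact: nm_ge0.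
    by rewrite /M le_max; case: (ord2P s) => ->; rewrite lexx ?orbT.
  have := nmD (v 0 0 *: (g *m delta_mx 0 0)) (v 1 0 *: (g *m delta_mx 1 0)).
  rewrite !nmZ => h'; have := h 0; have := h 1; lra.
have vd s : vnorm (delta_mx s 0) = 1.
  by rewrite /vnorm; case: (ord2P s) => ->; rewrite !mxE /= ?expr1n ?expr0n /= ?addr0 ?add0r sqrtr1.
split=> [s|].
  apply: (le_trans (vnorm_ge _)); apply: ub_le_sup; first by exists (4 * M).
  by exists (delta_mx s 0) => //=.
apply: ge_sup => //; exists (vnorm (g *m delta_mx 0 0)).
by exists (delta_mx 0 0) => //=.
Qed.

Lemma iterate_cons k (B : cocycle k) j (u : seq 'I_k) : iterate B (j :: u) = iterate B u *m B j.
Proof.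
rewrite /iterate /= mulmx1; elim: u (B j) => [|i u IH] M /=; first by rewrite mul1mx.
by rewrite IH mulmx1 (IH (B i)) mulmxA.
Qed.

Lemma iterate_cat k (B : cocycle k) (u x : seq 'I_k) :
  iterate B (u ++ x) = iterate B x *m iterate B u.
Proof.
elim: u => [|j u IH]; first by rewrite /= {3}/iterate /= mulmx1.
by rewrite /= !iterate_cons IH mulmxA.
Qed.

(** * Large deviations from uniform growth *)

(** A two-sided Fekete argument. Comparing [a] at a common multiple of two indices shows that every
    lower slope [(a n - D) / n] is at most every upper slope [(a m + D) / m]; the supremum of the
    lower slopes separates the two families. *)
Lemma almost_additive_slope (a : nat -> RR) (D : RR) :
  (forall m n, `|a (m + n)%N - a m - a n| <= D) ->
  exists L : RR, forall n, `|a n - n%:R * L| <= D.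
Proof.
move=> h.
have mul q n : `|a (q.+1 * n)%N - q.+1%:R * a n| <= q%:R * D.
  elim: q => [|q IH]; first by rewrite mul1n mul1r subrr normr0 mul0r.
  rewrite mulSn; move: IH (h n (q.+1 * n)%N); rewrite -![q.+2%:R]natr1 -![q.+1%:R]natr1.
  rewrite !ler_norml => /andP[? ?] /andP[? ?]; apply/andP; split; lra.
have key m n : (a n.+1 - D) / n.+1%:R <= (a m.+1 + D) / m.+1%:R.
  rewrite ler_pdivrMr ?ltr0n// mulrAC ler_pdivlMr ?ltr0n//.
  move: (mul m n.+1) (mul n m.+1); rewrite mulnC -![_.+1%:R]natr1.
  rewrite !ler_norml => /andP[? ?] /andP[? ?].
  have D0 : 0 <= D by exact: le_trans (normr_ge0 _) (h 0 0)%N.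
  lra.
pose S := [set (a n.+1 - D) / n.+1%:R | n in setT]%classic.
have ubS m : ubound S ((a m.+1 + D) / m.+1%:R) by move=> _ [n _ <-]; exact: key.
exists (sup S) => -[|n].
  (* At index 0 no slope is available, but almost additivity at [(0, 0)] says directly that
     [|a 0| <= D]. *)
  by rewrite mul0r subr0; have := h 0%N 0%N; rewrite addn0 subrr sub0r normrN.
have h1 : (a n.+1 - D) / n.+1%:R <= sup S.
  by apply: ub_le_sup; [exists ((a 1%N + D) / 1%:R); exact: (ubS 0%N) | exists n].
have h2 : sup S <= (a n.+1 + D) / n.+1%:R.
  by apply: ge_sup; [exists ((a 1%N - D) / 1%:R), 0%N | exact: ubS].
move: h1 h2; rewrite ler_pdivrMr ?ltr0n// ler_pdivlMr ?ltr0n// => h1 h2.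
rewrite ler_norml; apply/andP; split; lra.
Qed.

(** In the quadratic bound of the exponential the linear term averages to zero. *)
Lemma centered_mgf_le k (p : 'I_k -> RR) (xi : 'I_k -> RR) (t d : RR) :
  prob_vec p -> \sum_j p j * xi j = 0 -> (forall j, `|xi j| <= d) ->
  `|t| * d <= 2^-1 -> \sum_j p j * expR (t * xi j) <= expR (2 * (t * d) ^+ 2).
Proof.
move=> hp x0 xd td.
have d0 (j : 'I_k) : 0 <= d by exact: le_trans (normr_ge0 _) (xd j).
have b j : `|t * xi j| <= `|t| * d by rewrite normrM ler_wpM2l.
have h j : expR (t * xi j) <= 1 + t * xi j + 2 * (t * d) ^+ 2.
  apply: (le_trans (expR_le_quad _)).
    exact: le_trans (ler_norm _) (le_trans (b j) td).
  rewrite lerD2l ler_wpM2l// -[leLHS]real_normK ?num_real// -[leRHS]real_normK ?num_real//.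
  by rewrite lerXn2r ?nnegrE// normrM [in leRHS]normrM ler_wpM2l// (ger0_norm (d0 j)).
apply: (@le_trans _ _ (\sum_j p j * (1 + t * xi j + 2 * (t * d) ^+ 2))).
  by apply: ler_sum => j _; rewrite ler_wpM2l// ltW// hp.1.
have -> : \sum_j p j * (1 + t * xi j + 2 * (t * d) ^+ 2) = 1 + 2 * (t * d) ^+ 2.
  rewrite (eq_bigr (fun j => p j * (1 + 2 * (t * d) ^+ 2) + t * (p j * xi j))); last first.
    by move=> j _; ring.
  by rewrite big_split/= -big_distrl -big_distrr/= hp.2 x0 mulr0 addr0 mul1r.
exact: expR_ge1Dx.
Qed.

(** Both bounds on [c] together give [c <= 2 C exp (- s (X + Y) / 2)], whatever the sign of [X + Y].
    The inequality between geometric and arithmetic mean then splits the exponential into one term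
    in [X] and one in [Y]. *)
Lemma exp_min_le (s X Y c C : RR) : 0 < s <= 1 -> 0 <= C -> c <= 2 * C ->
  c <= 2 * C * expR (- (X + Y)) -> c <= C * (expR (- s * X) + expR (- s * Y)).
Proof.
move=> /andP[s0 s1] C0 c1 c2.
have h : c <= 2 * C * expR (- (s / 2) * (X + Y)).
  case: (leP 0 (X + Y)) => XY.
    apply: (le_trans c2); apply: ler_wpM2l; [lra | rewrite ler_expR; nra].
  apply: (le_trans c1); rewrite -[leLHS]mulr1; apply: ler_wpM2l; first lra.
  by rewrite -[leLHS]expR0 ler_expR; nra.
apply: (le_trans h); rewrite [2 * C]mulrC -mulrA ler_wpM2l//.
have -> : - (s / 2) * (X + Y) = - (s / 2) * X + - (s / 2) * Y by ring.
have -> : - s * X = - (s / 2) * X + - (s / 2) * X by field.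
have -> : - s * Y = - (s / 2) * Y + - (s / 2) * Y by field.
rewrite !expRD; have := sqr_ge0 (expR (- (s / 2) * X) - expR (- (s / 2) * Y)).
rewrite sqrrB; lra.
Qed.

Section LargeDeviations.
Variables (k : nat) (p : 'I_k -> RR) (B : cocycle k) (kap : RR) (m0 : nat).
Hypotheses (hp : prob_vec p) (hdet : forall j, inSL (B j)) (hkap : expR 1 <= kap)
  (hB1 : forall j v, nm (B j *m v) <= kap * nm v)
  (hB2 : forall j v, nm v <= kap * nm (B j *m v))
  (m0_gt0 : (0 < m0)%N)
  (growth : forall v, v != 0 ->
    ln (nm v) + 1 <= Ex p m0 (fun u => ln (nm (iterate B u *m v)))).

Local Notation lg v := (ln (nm v)).
(** The constants, in order: [l] bounds one step of the log-norm and [T] bounds [m0] steps. The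
    exponent [s] makes the quadratic error [2 (s T)^2] equal to [s / 2], half of the linear gain.
    [D0] bounds the sum over all times of the negative moments [Psi], [D] the dependence of
    [F n v - lg v] on the direction, and [Dp] the martingale increments. *)
Let l : RR := ln kap.
Let T : RR := m0%:R * l.
Let s : RR := (4 * T ^+ 2)^-1.
Let D0 : RR := 4 * m0%:R / s.
Let D : RR := 2 * kap ^+ 2 * D0.
Let Dp : RR := D + 2 * l.
Let F n v := Ex p n (fun u => lg (iterate B u *m v)).
Let Psi m v := Ex p m (fun u => expR (- s * (lg (iterate B u *m v) - lg v))).

Let kap_ge2 : 2 <= kap.
Proof. by apply: le_trans hkap; have := expR_ge1Dx (1 : RR). Qed.

Let l_ge1 : 1 <= l.
Proof.
by rewrite -[leLHS]expRK /l ler_ln ?posrE ?expR_gt0//; apply: lt_le_trans kap_ge2.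
Qed.

Let l_le : l <= kap ^+ 2.
Proof.
have k1 : -1 < kap - 1 by move: kap_ge2; lra.
by have := le_ln1Dx k1; rewrite addrC subrK -/l; move: kap_ge2; nra.
Qed.

Let T_ge1 : 1 <= T.
Proof. by have m1 : 1 <= m0%:R :> RR; [rewrite ler1n | rewrite /T; move: l_ge1; nra]. Qed.

Let s_bd : 0 < s <= 1.
Proof.
have T1 : 1 <= 4 * T ^+ 2 by move: T_ge1; nra.
have T0 : 0 < 4 * T ^+ 2 by exact: lt_le_trans T1.
by rewrite /s invr_gt0 T0 invf_le1.
Qed.

Let sT : s * T <= 2^-1 /\ 2 * (s * T) ^+ 2 = s / 2.
Proof.
have T0 : T != 0 by rewrite gt_eqF// (lt_le_trans _ T_ge1).
split; last by rewrite /s; field.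
rewrite /s; have -> : (4 * T ^+ 2)^-1 * T = 4^-1 * T^-1 by field.
have : T^-1 <= 1 by rewrite invf_le1// (lt_le_trans _ T_ge1).
lra.
Qed.

Lemma step_neq0 j v : v != 0 -> B j *m v != 0.
Proof. move=> /nm_gt0 v0; apply: nm0P; have := hB2 j v; move: kap_ge2; nra. Qed.

Lemma iter_neq0 (u : seq 'I_k) v : v != 0 -> iterate B u *m v != 0.
Proof.
elim: u v => [|j u IH] v v0; first by rewrite /iterate /= mul1mx.
by rewrite iterate_cons -mulmxA IH// step_neq0.
Qed.

Lemma lg_step j v : v != 0 -> `|lg (B j *m v) - lg v| <= l.
Proof.
move=> v0; have n0 := nm_gt0 v0; have n1 := nm_gt0 (step_neq0 j v0).
have k0 : 0 < kap by move: kap_ge2; lra.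
have : lg (B j *m v) <= ln (kap * nm v) by rewrite ler_ln ?posrE ?mulr_gt0.
have : lg v <= ln (kap * nm (B j *m v)) by rewrite ler_ln ?posrE ?mulr_gt0.
rewrite !lnM ?posrE// -/l ler_norml => h1 h2; apply/andP; split; lra.
Qed.

Lemma lg_iter (u : seq 'I_k) v : v != 0 ->
  `|lg (iterate B u *m v) - lg v| <= (size u)%:R * l.
Proof.
elim: u v => [|j u IH] v v0 /=; first by rewrite /iterate /= mul1mx subrr normr0 mul0r.
rewrite iterate_cons -mulmxA; move: (IH _ (step_neq0 j v0)) (lg_step j v0).
rewrite -natr1 mulrDl mul1r !ler_norml => /andP[? ?] /andP[? ?]; apply/andP; split; lra.
Qed.

(** Expanding to second order, the mean growth of at least 1 contributes [- s] and the quadratic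
    error at most [s / 2]. *)
Lemma Psi_growth v : v != 0 -> Psi m0 v <= 1 - s / 2.
Proof.
move=> v0; have [sT1 sT2] := sT; have /andP[s0 s1] := s_bd.
have h (u : seq 'I_k) : size u = m0 ->
    expR (- s * (lg (iterate B u *m v) - lg v)) <=
    (1 + s / 2) - s * (lg (iterate B u *m v) - lg v).
  move=> su; have := lg_iter u v0; rewrite su -/T.
  set X := lg _ - lg v => hX.
  have hsX : `|- s * X| <= s * T by rewrite normrM normrN (gtr0_norm s0) ler_wpM2l// ltW.
  apply: (le_trans (expR_le_quad _)); first exact: le_trans (ler_norm _) (le_trans hsX sT1).
  have q : (- s * X) ^+ 2 <= (s * T) ^+ 2.
    by rewrite -[leLHS]real_normK ?num_real// lerXn2r ?nnegrE// (le_trans _ hsX).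
  lra.
apply: (le_trans (le_Ex hp h)); rewrite Ex_sub Ex_const// Ex_scale Ex_sub Ex_const//.
by have := growth v0; nra.
Qed.

Lemma Psi_small m v : v != 0 -> (m <= m0)%N -> Psi m v <= 2.
Proof.
move=> v0 hm; apply: Ex_le => // u su; have [sT1 sT2] := sT; have /andP[s0 s1] := s_bd.
have := lg_iter u v0; rewrite su; set X := lg _ - lg v => hX.
have hX' : `|X| <= T.
  by apply: (le_trans hX); rewrite /T ler_wpM2r ?ler_nat//; move: l_ge1; lra.
have hsX : - s * X <= 2^-1.
  move: hX'; rewrite ler_norml => /andP[? ?]; nra.
apply: (@le_trans _ _ (expR 2^-1)); first by rewrite ler_expR.
by apply: (le_trans (expR_le_quad _)); lra.
Qed.

Lemma Psi_cat m n v : v != 0 -> Psi (m + n) v =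
  Ex p m (fun u => expR (- s * (lg (iterate B u *m v) - lg v)) * Psi n (iterate B u *m v)).
Proof.
move=> v0; rewrite /Psi Ex_cat; apply: eq_Ex => u su; rewrite -Ex_scale.
apply: eq_Ex => x sx; rewrite iterate_cat -mulmxA -expRD; congr expR; ring.
Qed.

Let D0_ge0 : 0 <= D0.
Proof. by rewrite /D0 divr_ge0// ?mulr_ge0//; have /andP[/ltW] := s_bd. Qed.

(** A renewal argument by strong induction on [M]. The first [m0] terms add up to at most [2 m0];
    the others are a weighted average of shorter sums, hence at most [D0 (1 - s / 2)] by
    [Psi_growth]. The total is [D0] because [D0 s = 4 m0]. *)
Lemma sum_Psi M v : v != 0 -> \sum_(m < M) Psi m v <= D0.
Proof.
have /andP[s0 s1] := s_bd.
have eD : D0 * s = 4 * m0%:R by rewrite /D0 divfK// gt_eqF.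
elim/ltn_ind: M v => M IH v v0.
have small M' : (M' <= m0)%N -> \sum_(m < M') Psi m v <= 2 * m0%:R.
  move=> hM; apply: (@le_trans _ _ (\sum_(m < M') 2)).
    by apply: ler_sum => m _; apply: Psi_small => //; exact: leq_trans (ltnW (ltn_ord m)) hM.
  by rewrite sumr_const card_ord -[2 *+ M']mulr_natr ler_wpM2l// ler_nat.
case: (leqP M m0) => hM.
  by apply: (le_trans (small _ hM)); move: D0_ge0; nra.
rewrite -(subnKC (ltnW hM)) big_split_ord/=.
have -> : \sum_(i < M - m0) Psi (m0 + i) v = Ex p m0 (fun u =>
    expR (- s * (lg (iterate B u *m v) - lg v)) *
    \sum_(i < M - m0) Psi i (iterate B u *m v)).
  rewrite [RHS](@eq_Ex _ _ _ _ (fun u => \sum_(i < M - m0)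
    expR (- s * (lg (iterate B u *m v) - lg v)) * Psi i (iterate B u *m v))).
    by rewrite Ex_sum; apply: eq_bigr => i _; exact: Psi_cat.
  by move=> u _; exact: big_distrr.
have h : Ex p m0 (fun u => expR (- s * (lg (iterate B u *m v) - lg v)) *
    \sum_(i < M - m0) Psi i (iterate B u *m v)) <= D0 * Psi m0 v.
  rewrite /Psi -Ex_scale; apply: le_Ex => // u _; rewrite mulrC ler_wpM2r ?expR_ge0//.
  by apply: IH; [rewrite ltn_subrL m0_gt0 (leq_ltn_trans _ hM) | exact: iter_neq0].
have := small _ (leqnn m0); have := Psi_growth v0; move: D0_ge0 h; nra.
Qed.

(** One-step growth is Lipschitz in the projective distance: write [v] as a multiple of [w] plus a
    remainder controlled by the wedge product ([nm_align]), apply [B j], and use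
    [ln (1 + x) <= x]. *)
Lemma step_diff j v w : v != 0 -> w != 0 ->
  (lg (B j *m v) - lg v) - (lg (B j *m w) - lg w) <=
  kap ^+ 2 * (`|wedge v w| / (nm v * nm w)).
Proof.
move=> v0 w0; have [nv nw] := (nm_gt0 v0, nm_gt0 w0).
have [nBv nBw] := (nm_gt0 (step_neq0 j v0), nm_gt0 (step_neq0 j w0)).
set d := _ / (nm v * nm w).
have d0 : 0 <= d by rewrite /d divr_ge0// mulr_ge0// ltW.
have [lam [h1 h2]] := nm_align v w0.
have ed : `|wedge v w| = d * (nm v * nm w) by rewrite /d divfK// mulf_neq0// gt_eqF.
have k2 := kap_ge2.
have h3 : nm (B j *m v) <= `|lam| * nm (B j *m w) + kap * nm (v - lam *: w).
  have -> : B j *m v = lam *: (B j *m w) + B j *m (v - lam *: w).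
    by rewrite mulmxBr -scalemxAr addrC subrK.
  by apply: (le_trans (nmD _ _)); rewrite nmZ lerD2l; apply: hB1.
have h4 : nm (B j *m v) * nm w <= nm v * nm (B j *m w) * (1 + kap ^+ 2 * d).
  apply: (@le_trans _ _ (nm v * nm (B j *m w) + kap * (d * (nm v * nm w)))).
    rewrite -ed -h2.
    apply: (le_trans (ler_wpM2r (ltW nw) h3)); rewrite mulrDl mulrAC mulrA lerD2r.
    by rewrite ler_wpM2r// ltW.
  have h5 : d * nm v * nm w <= d * nm v * (kap * nm (B j *m w)).
    by rewrite ler_wpM2l ?hB2// mulr_ge0// ltW.
  have := ler_wpM2l (_ : 0 <= kap) h5; move=> /(_ ltac:(lra)).
  rewrite expr2; lra.
have q0 : 0 < 1 + kap ^+ 2 * d by rewrite ltr_pwDl// mulr_ge0// sqr_ge0.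
have h6 : ln (nm (B j *m v) * nm w) <= ln (nm v * nm (B j *m w) * (1 + kap ^+ 2 * d)).
  by rewrite ler_ln ?posrE// !mulr_gt0.
have h7 : ln (1 + kap ^+ 2 * d) <= kap ^+ 2 * d by apply: le_ln1Dx; lra.
move: h6; rewrite !lnM ?posrE ?mulr_gt0//; lra.
Qed.

Lemma wedge_iter (u : seq 'I_k) v w :
  `|wedge (iterate B u *m v) (iterate B u *m w)| = `|wedge v w|.
Proof.
elim: u v w => [|j u IH] v w; first by rewrite /iterate /= !mul1mx.
rewrite iterate_cons -!mulmxA IH wedge_mul normrM.
by case: (hdet j) => ->; rewrite ?normrN normr1 mul1r.
Qed.

(** The wedge product of two orbits is conserved, so their projective distance is at most
    [2 exp (- (X + Y))], where [X] and [Y] are the two log-growths. The trivial bound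
    [2 l <= 2 kap^2] covers orbits that have shrunk, and [exp_min_le] turns both bounds into
    integrands of [Psi]. *)
Lemma step_diff_iter j (u : seq 'I_k) v w : v != 0 -> w != 0 ->
  (lg (B j *m (iterate B u *m v)) - lg (iterate B u *m v)) -
  (lg (B j *m (iterate B u *m w)) - lg (iterate B u *m w)) <=
  kap ^+ 2 * (expR (- s * (lg (iterate B u *m v) - lg v))
            + expR (- s * (lg (iterate B u *m w) - lg w))).
Proof.
move=> v0 w0; have [v1 w1] := (iter_neq0 u v0, iter_neq0 u w0).
apply: exp_min_le => //; first exact: sqr_ge0.
  move: (lg_step j v1) (lg_step j w1) l_le; rewrite !ler_norml => /andP[? ?] /andP[? ?]; lra.
apply: (le_trans (step_diff j v1 w1)); rewrite wedge_iter.
have -> : 2 * kap ^+ 2 = kap ^+ 2 * 2 by ring.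
rewrite -mulrA ler_wpM2l ?sqr_ge0//.
have [nv nw nv1 nw1] := And4 (nm_gt0 v0) (nm_gt0 w0) (nm_gt0 v1) (nm_gt0 w1).
rewrite ler_pdivrMr ?mulr_gt0//; apply: (le_trans (wedge_le _ _)).
rewrite -mulrA ler_wpM2l//.
have -> : - (lg (iterate B u *m v) - lg v + (lg (iterate B u *m w) - lg w)) =
  (lg v + lg w) - (lg (iterate B u *m v) + lg (iterate B u *m w)) by ring.
by rewrite expRB !expRD !lnK ?posrE// divfK// mulf_neq0// gt_eqF.
Qed.

(** Telescoping in time: step [n] changes the left side by at most [kap^2 (Psi n v + Psi n w)], and
    [sum_Psi] bounds each of the two series by [D0]. *)
Lemma F_diff n v w : v != 0 -> w != 0 ->
  (F n v - lg v) - (F n w - lg w) <= D.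
Proof.
move=> v0 w0.
have ar0 (a b : RR) : (a - a) - (b - b) <= 0 by lra.
have ar (a a' b b' x y M N P : RR) : (a - x) - (b - y) <= M ->
  (a' - a) - (b' - b) <= N -> M + N = P -> (a' - x) - (b' - y) <= P by lra.
have psum x : x != 0 -> exists Q : nat -> RR,
    [/\ Q 0%N = 0, forall m, Q m.+1 = Q m + Psi m x & forall m, Q m <= D0].
  move=> x0; exists (fun N => \sum_(m < N) Psi m x); split=> [|m|m]; first exact: big_ord0.
    exact: big_ord_recr.
  exact: sum_Psi.
have [Qv [Qv0 QvS Qv_le]] := psum v v0; have [Qw [Qw0 QwS Qw_le]] := psum w w0.
have h : (F n v - lg v) - (F n w - lg w) <= kap ^+ 2 * (Qv n + Qw n).
  elim: n => [|n IH].
    have F0 x : F 0 x = lg x by rewrite /F [Ex _ _ _]/= /iterate [foldl _ _ _]/= mul1mx.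
    by rewrite Qv0 Qw0 addr0 mulr0 (F0 v) (F0 w); exact: ar0.
  have step x : x != 0 -> F n.+1 x = F n x +
      Ex p n (fun u => \sum_j p j * (lg (B j *m (iterate B u *m x)) - lg (iterate B u *m x))).
    move=> x0; rewrite /F -addn1 Ex_cat -Ex_add; apply: eq_Ex => u _ /=.
    rewrite -[X in _ = X + _]mul1r -hp.2 big_distrl -big_split/=; apply: eq_bigr => j _.
    rewrite iterate_cat /iterate /= mulmx1 -mulmxA; ring.
  have {}step : (F n.+1 v - F n v) - (F n.+1 w - F n w) <= kap ^+ 2 * (Psi n v + Psi n w).
    rewrite !step// [_ + _ - F n v]addrAC subrr add0r [_ + _ - F n w]addrAC subrr add0r.
    rewrite -Ex_sub /Psi -Ex_add -Ex_scale; apply: le_Ex => // u _.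
    rewrite -sumrB -[leRHS]mul1r -hp.2 big_distrl/=; apply: ler_sum => j _.
    by rewrite -mulrBr ler_wpM2l ?step_diff_iter// ltW// hp.1.
  rewrite QvS QwS; apply: (ar _ _ _ _ _ _ _ _ _ IH step).
  by rewrite -mulrDr addrACA.
have eD (d : RR) : 2 * kap ^+ 2 * d = kap ^+ 2 * (d + d) by ring.
by apply: (le_trans h); rewrite /D eD; apply: ler_wpM2l; [exact: sqr_ge0 | exact: lerD].
Qed.

Let D_ge0 : 0 <= D.
Proof. by rewrite /D mulr_ge0// mulr_ge0// sqr_ge0. Qed.

Let Dp_ge2 : 2 <= Dp.
Proof. by rewrite /Dp; move: D_ge0 l_ge1; lra. Qed.

Lemma F_succ n v : F n.+1 v = \sum_j p j * F n (B j *m v).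
Proof.
rewrite /F /=; apply: eq_bigr => j _; congr (_ * _); apply: eq_Ex => u _.
by rewrite iterate_cons mulmxA.
Qed.

(** Azuma's argument, revealing the letters from the first one on. The increment [xi j] is centered
    by [F_succ]. It is also an average of differences [F n (B j *m v) - F n (B i *m v)], which
    [F_diff] and [lg_step] bound by [Dp]. *)
Lemma mgf_le n v t : v != 0 -> `|t| * Dp <= 2^-1 ->
  Ex p n (fun u => expR (t * (lg (iterate B u *m v) - F n v))) <=
  expR (2 * (t * Dp) ^+ 2 * n%:R).
Proof.
move=> v0 ht; elim: n v v0 => [|n IH] v v0.
  by rewrite /= /F /= subrr !mulr0.
pose xi j := F n (B j *m v) - F n.+1 v.
apply: (@le_trans _ _ (\sum_j p j * expR (t * xi j) * expR (2 * (t * Dp) ^+ 2 * n%:R))).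
  rewrite [leLHS]/=; apply: ler_sum => j _; rewrite -mulrA ler_wpM2l// ?(ltW (hp.1 j))//.
  apply: le_trans (ler_wpM2l (expR_ge0 _) (IH _ (step_neq0 j v0))).
  rewrite -Ex_scale le_eqVlt; apply/orP; left; apply/eqP; apply: eq_Ex => u _.
  by rewrite -expRD iterate_cons mulmxA /xi; congr expR; ring.
have -> : 2 * (t * Dp) ^+ 2 * n.+1%:R = 2 * (t * Dp) ^+ 2 + 2 * (t * Dp) ^+ 2 * n%:R.
  by rewrite -[n.+1%:R]natr1 mulrDr mulr1 addrC.
rewrite -big_distrl/= expRD ler_wpM2r ?expR_ge0//.
have F_le i j : F n (B j *m v) - F n (B i *m v) <= Dp.
  have := F_diff n (step_neq0 j v0) (step_neq0 i v0).
  move: (lg_step j v0) (lg_step i v0); rewrite /Dp !ler_norml => /andP[? ?] /andP[? ?]; lra.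
have xiE j : xi j = \sum_i p i * (F n (B j *m v) - F n (B i *m v)).
  rewrite /xi F_succ; under [RHS]eq_bigr do rewrite mulrBr.
  by rewrite sumrB -big_distrl/= hp.2 mul1r.
have avg c (f : 'I_k -> RR) : (forall i, f i <= c) -> \sum_i p i * f i <= c.
  move=> h; rewrite -[leRHS]mul1r -hp.2 big_distrl/=; apply: ler_sum => i _.
  by rewrite ler_wpM2l// ltW// hp.1.
apply: centered_mgf_le => //.
  rewrite /xi; under eq_bigr do rewrite mulrBr.
  by rewrite sumrB -F_succ -big_distrl/= hp.2 mul1r subrr.
move=> j; rewrite ler_norml; apply/andP; split.
  rewrite lerNl xiE -sumrN; under eq_bigr do rewrite -mulrN.
  by apply: avg => i; rewrite opprB; exact: F_le.
by rewrite xiE; apply: avg => i; exact: F_le.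
Qed.

Local Notation e r := (delta_mx r 0 : 'cV[RR]_2).

Let nm_e r : nm (e r) = 1.
Proof.
rewrite /nm !mxE; case: (ord2P r) => -> /=; rewrite normr1 normr0.
  exact/max_idPl.
exact/max_idPr.
Qed.

Let e_neq0 r : e r != 0.
Proof. by apply: nm0P; rewrite nm_e. Qed.

(** After [m] steps the orbit continues from some random direction, which changes the expected
    further growth by at most [D]; hence [F] at the first basis vector is almost additive. Passing
    to the other basis vector costs a second [D]. *)
Lemma F_slope : exists L : RR, forall n r, `|F n (e r) - n%:R * L| <= 2 * D.
Proof.
have lge r : lg (e r) = 0 by rewrite nm_e ln1.
have dF n x r : x != 0 -> `|F n x - lg x - F n (e r)| <= D.
  move=> x0; have := F_diff n x0 (e_neq0 r); have := F_diff n (e_neq0 r) x0.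
  move: (lge r); move: (F n x) (F n (e r)) (lg (e r)) (lg x) D => a b c d C -> h1 h2.
  rewrite ler_norml; apply/andP; split; lra.
have add m n : `|F (m + n) (e 0) - F m (e 0) - F n (e 0)| <= D.
  have -> : F (m + n) (e 0) - F m (e 0) - F n (e 0) =
      Ex p m (fun u => F n (iterate B u *m e 0) - lg (iterate B u *m e 0) - F n (e 0)).
    rewrite !Ex_sub Ex_const//; congr (_ - _ - _).
    rewrite {1}/F Ex_cat; apply: eq_Ex => u _; apply: eq_Ex => x _.
    by rewrite iterate_cat mulmxA.
  rewrite ler_norml; apply/andP; split.
    apply: Ex_ge => // u _; have := dF n _ 0 (iter_neq0 u (e_neq0 0)).
    by rewrite ler_norml => /andP[].
  apply: Ex_le => // u _; have := dF n _ 0 (iter_neq0 u (e_neq0 0)).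
  by rewrite ler_norml => /andP[].
have [L hL] := almost_additive_slope add; exists L => n r.
have := dF n _ 0 (e_neq0 r); rewrite lge subr0 => h1.
have -> : F n (e r) - n%:R * L = (F n (e r) - F n (e 0)) + (F n (e 0) - n%:R * L) by ring.
have -> : 2 * D = D + D by ring.
by apply: (le_trans (ler_normD _ _)); exact: lerD h1 (hL n).
Qed.

Lemma ln_opnorm_bounds (u : seq 'I_k) :
  (forall r, lg (iterate B u *m e r) <= ln (opnorm (iterate B u))) /\
  (exists r, ln (opnorm (iterate B u)) <= 2 + lg (iterate B u *m e r)).
Proof.
have [h1 h2] := opnorm_bounds (iterate B u).
have n0 r := nm_gt0 (iter_neq0 u (e_neq0 r)).
have o0 : 0 < opnorm (iterate B u) by exact: lt_le_trans (n0 0) (h1 0).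
split=> [r|]; first by rewrite ler_ln ?posrE.
have ln4 : ln 4 <= 2 :> RR.
  rewrite -[leRHS]expRK ler_ln ?posrE ?expR_gt0//.
  have e1 : 2 <= expR 1 :> RR by have := expR_ge1Dx (1 : RR).
  have -> : 2 = 1 + 1 :> RR by [].
  by rewrite expRD; nra.
have hs r : opnorm (iterate B u) <= 4 * nm (iterate B u *m e r) ->
    ln (opnorm (iterate B u)) <= 2 + lg (iterate B u *m e r).
  move=> h; apply: (@le_trans _ _ (ln (4 * nm (iterate B u *m e r)))).
    by rewrite ler_ln ?posrE// mulr_gt0.
  by rewrite lnM ?posrE// lerD2r.
case: (leP (nm (iterate B u *m e 0)) (nm (iterate B u *m e 1))) => h.
  by exists 1; apply: hs; move: h2; rewrite (max_idPr h).
by exists 0; apply: hs; move: h2; rewrite (max_idPl (ltW h)).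
Qed.

(** The operator norm is governed by the larger of two basis orbits. The mean of this maximum is
    controlled by exponential moments, which leaves an error of order [q], the square root of
    [n]. *)
Lemma Elog_slope L : (forall n r, `|F n (e r) - n%:R * L| <= 2 * D) ->
  forall n q, 1 <= q -> q ^+ 2 = n%:R ->
  `|Elog p B n - n%:R * L| <= (2 + 2 * D + 8 * Dp) * q.
Proof.
move=> hL n q q1 qn.
have ar0 (x y : RR) : 0 <= x -> 0 <= y -> x <= x + y /\ y <= x + y by move=> *; split; lra.
have ar1 (x y c d w : RR) : c - y <= x -> y - w <= 2 * d -> 2 + c <= 2 + 2 * d + w + x by lra.
have ar2 (x y d d' w : RR) : 1 <= q -> 2 <= d' -> 0 <= d -> y <= x ->
    x <= 2 + 2 * d + w + 2 * d' * q * (2 + 2) -> - (2 * d) <= y - w ->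
    `|x - w| <= (2 + 2 * d + 8 * d') * q.
  by move=> *; rewrite ler_norml; apply/andP; split; nra.
have Dp2 := Dp_ge2; have Dge0 := D_ge0.
have -> : Elog p B n = Ex p n (fun u => ln (opnorm (iterate B u))) by rewrite Ex_tupleE.
(* With this [t] the exponent [2 (t Dp)^2 n] of [mgf_le] equals [1 / 2], so both moments are at most
   2. *)
pose t := (2 * Dp * q)^-1.
have tq : t * (2 * Dp * q) = 1 by rewrite mulVf// !mulf_neq0// gt_eqF//; lra.
have t0 : 0 < t by rewrite invr_gt0 !mulr_gt0//; lra.
have tDp : t * Dp * q = 2^-1 by lra.
have tDp0 : 0 < t * Dp by rewrite mulr_gt0//; lra.
have tD : `|t| * Dp <= 2^-1 by rewrite gtr0_norm//; nra.
have mgf r : Ex p n (fun u => expR (t * (lg (iterate B u *m e r) - F n (e r)))) <= 2.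
  apply: (le_trans (mgf_le n (e_neq0 r) tD)).
  have -> : 2 * (t * Dp) ^+ 2 * n%:R = 2^-1.
    by rewrite -qn -mulrA -exprMn tDp; field.
  by apply: (le_trans (expR_le_quad _)); lra.
have low : F n (e 0) <= Ex p n (fun u => ln (opnorm (iterate B u))).
  by apply: le_Ex => // u _; have [h _] := ln_opnorm_bounds u.
have up : Ex p n (fun u => ln (opnorm (iterate B u))) <= (2 + 2 * D + n%:R * L) +
    t^-1 * (2 + 2).
  apply: (@le_trans _ _ (Ex p n (fun u => (2 + 2 * D + n%:R * L) + t^-1 *
     (expR (t * (lg (iterate B u *m e 0) - F n (e 0))) +
      expR (t * (lg (iterate B u *m e 1) - F n (e 1))))))).
    apply: le_Ex => // u _; have [_ [r hs]] := ln_opnorm_bounds u.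
    apply: (le_trans hs).
    (* The inequality [x <= exp (t x) / t] lets the sum of both exponentials dominate the deviation
       of whichever basis vector [r] is relevant. *)
    have h1 : lg (iterate B u *m e r) - F n (e r) <=
        t^-1 * expR (t * (lg (iterate B u *m e r) - F n (e r))).
      rewrite -(ler_pM2l t0) mulrA divff ?gt_eqF// mul1r.
      by apply: le_trans (expR_ge1Dx _); rewrite lerDr.
    have h2 : t^-1 * expR (t * (lg (iterate B u *m e r) - F n (e r))) <=
        t^-1 * (expR (t * (lg (iterate B u *m e 0) - F n (e 0))) +
      expR (t * (lg (iterate B u *m e 1) - F n (e 1)))).
      apply: ler_wpM2l; first by rewrite invr_ge0 ltW.
      have [c0 c1] := ar0 _ _ (expR_ge0 (t * (lg (iterate B u *m e 0) - F n (e 0))))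
        (expR_ge0 (t * (lg (iterate B u *m e 1) - F n (e 1)))).
      by case: (ord2P r) => ->; [exact: c0 | exact: c1].
    have := hL n r; rewrite ler_norml => /andP[_ h3].
    exact: ar1 (le_trans h1 h2) h3.
  rewrite Ex_add Ex_const// lerD2l Ex_scale; apply: ler_wpM2l; first by rewrite invr_ge0 ltW.
  by rewrite Ex_add; exact: lerD.
move: up; rewrite /t invrK => up.
have := hL n 0; rewrite ler_norml => /andP[h1 _].
exact: ar2 q1 Dp2 Dge0 low up h1.
Qed.

Lemma lyap_slope L : (forall n r, `|F n (e r) - n%:R * L| <= 2 * D) -> lyap p B = L.
Proof.
move=> hL; apply: cvg_lim; first exact: Rhausdorff.
suff: ((fun n => n.+1%:R^-1 * Elog p B n.+1 : RR^o) @ \oo --> (L : RR^o))%classic by [].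
have Dp2 := Dp_ge2; have Dge0 := D_ge0.
pose C := 2 + 2 * D + 8 * Dp.
have C0 : 0 < C by rewrite /C; lra.
(* Beyond this index the square root of [n + 1] exceeds [C / eps], which makes the error
   [C q / (n + 1) = C / q] smaller than [eps]. *)
apply/cvgrPdist_lt => eps eps0; exists (Num.truncn ((C / eps) ^+ 2)) => // n /= hn.
have n1 : 1 <= n.+1%:R :> RR by rewrite ler1n.
have n0 : 0 < n.+1%:R :> RR by rewrite ltr0n.
pose q := Num.sqrt (n.+1%:R : RR).
have q2 : q ^+ 2 = n.+1%:R by rewrite sqr_sqrtr// ltW.
have q1 : 1 <= q by rewrite -[leLHS]sqrtr1 ler_sqrt.
have q0 : 0 < q by exact: lt_le_trans q1.
have hq : C / eps < q.
  rewrite -(@ltr_pXn2r _ 2)// ?nnegrE ?divr_ge0 ?(ltW q0) ?(ltW C0) ?(ltW eps0)//.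
  by rewrite q2; apply: (lt_le_trans (truncnS_gt _)); rewrite ler_nat ltnS.
have := Elog_slope hL q1 q2; rewrite -/C => h.
have -> : L - n.+1%:R^-1 * Elog p B n.+1 = - (n.+1%:R^-1 * (Elog p B n.+1 - n.+1%:R * L)).
  by rewrite mulrBr mulrA mulVf ?gt_eqF// mul1r opprB.
rewrite normrN normrM gtr0_norm ?invr_gt0// mulrC ltr_pdivrMr//.
apply: (le_lt_trans h); rewrite -q2 expr2 mulrA ltr_pM2r//.
by move: hq; rewrite ltr_pdivrMr// mulrC.
Qed.

(** Chernoff's bound with [z] the sixth root of [n]: the deviation to exclude is [n / z = z^5]. The
    hypothesis on [z] reads [2 Dp^2 <= z], since [D0 = 16 l^2 m0^3]. *)
Lemma large_deviations n z : 0 < z -> z ^+ 6 = n%:R ->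
  2 * (32 * kap ^+ 2 * l ^+ 2 * m0%:R ^+ 3 + 2 * l) ^+ 2 <= z ->
  probn p (fun u : n.-tuple 'I_k =>
    z^-1 < `|(n%:R)^-1 * ln (opnorm (iterate B u)) - lyap p B|) < expR (- z).
Proof.
have -> : 32 * kap ^+ 2 * l ^+ 2 * m0%:R ^+ 3 + 2 * l = Dp.
  rewrite /Dp /D /D0 /s invrK /T; ring.
move=> z0 zn hz.
have ar1 (x1 x2 x3 w c d : RR) : x3 <= 2 + x1 -> c + c < x3 - w -> x2 - w <= 2 * d ->
  2 * d + 2 <= c -> c <= x1 - x2 by lra.
have ar2 (x1 x2 x3 w c d : RR) : x1 <= x3 -> c + c < - (x3 - w) -> - (2 * d) <= x2 - w ->
  2 * d + 2 <= c -> x1 - x2 <= - c by lra.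
have ar3 (x y w : RR) : 3 < w -> 0 < x -> 0 < y -> x * (y + y + y) < x * y * w.
  by move=> w3 x0 y0; have := mulr_gt0 x0 y0; nra.
have ar4 (x y w : RR) : 0 <= x -> 0 <= y -> 0 <= w ->
  [/\ x <= x + y + w, y <= x + y + w & w <= x + y + w] by move=> *; split; lra.
have Dp2 := Dp_ge2; have Dge0 := D_ge0; have l1 := l_ge1.
have [L hL] := F_slope; rewrite (lyap_slope hL).
have z8 : 8 <= z by nra.
have zDp : 4 * Dp <= z by nra.
have z5 : z <= z ^+ 5 by rewrite -[leLHS]expr1 ler_weXn2l//; lra.
have DDp : D + 2 <= Dp by rewrite /Dp; lra.
(* Half of the deviation absorbs the bounded errors [2 D + 2]. Since [t] is the inverse square root
   of [n], the moments are at most [exp (2 Dp^2) <= exp z], while the gain is [t a = z^2 / 2]. *)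
pose a := z ^+ 5 / 2; pose t := (z ^+ 3)^-1.
have z3 : 0 < z ^+ 3 by rewrite exprn_gt0.
have t0 : 0 < t by rewrite invr_gt0.
have tD : t * Dp <= 2^-1.
  rewrite mulrC ler_pdivrMr//; have : z <= z ^+ 3 by rewrite -[leLHS]expr1 ler_weXn2l//; lra.
  lra.
have ta : t * a = z ^+ 2 / 2 by rewrite /t /a; field; rewrite gt_eqF.
have tn : 2 * (t * Dp) ^+ 2 * n%:R = 2 * Dp ^+ 2.
  by rewrite -zn /t; field; rewrite gt_eqF.
pose X r u := lg (iterate B u *m e r) - F n (e r).
(* A large operator norm forces an upper deviation at one of the two basis vectors; a small one
   forces a lower deviation already at the first. Hence three exponentials. *)
pose G u := expR (- (t * a)) * (expR (t * X 0 u) + expR (t * X 1 u) + expR (- t * X 0 u)).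
have mgf t' r : `|t'| = t -> Ex p n (fun u => expR (t' * X r u)) <= expR z.
  move=> et; have et2 : t' ^+ 2 = t ^+ 2 by rewrite -[LHS]real_normK ?num_real// et.
  apply: (@le_trans _ _ _ _ _ (mgf_le n (e_neq0 r) _)); first by rewrite et.
  by rewrite ler_expR exprMn et2 -exprMn tn.
have EG : Ex p n G <= expR (- (t * a)) * (expR z + expR z + expR z).
  rewrite /G Ex_scale ler_wpM2l ?expR_ge0// !Ex_add.
  by rewrite !lerD// mgf// ?normrN gtr0_norm.
have hPG : probn p (fun u : n.-tuple 'I_k =>
    z^-1 < `|(n%:R)^-1 * ln (opnorm (iterate B u)) - L|) <= Ex p n G.
  apply: probn_Ex => // [u _|u hu].
    by rewrite /G mulr_ge0 ?expR_ge0// !addr_ge0 ?expR_ge0.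
  have Gge r : a <= X r u -> 1 <= G u.
    move=> h; have h' : 0 <= t * X r u - t * a.
      by rewrite -mulrBr; apply: mulr_ge0; [exact: ltW | rewrite subr_ge0].
    apply: (@le_trans _ _ (expR (- (t * a)) * expR (t * X r u))).
      by rewrite -expRD addrC -[leLHS]expR0 ler_expR.
    rewrite /G ler_wpM2l ?expR_ge0//.
    have [h1 h2 _] := ar4 _ _ _ (expR_ge0 (t * X 0 u)) (expR_ge0 (t * X 1 u))
      (expR_ge0 (- t * X 0 u)).
    by case: (ord2P r) => ->; [exact: h1 | exact: h2].
  have Gle : X 0 u <= - a -> 1 <= G u.
    move=> h; have h' : 0 <= - t * X 0 u - t * a.
      have -> : - t * X 0 u - t * a = t * (- X 0 u - a) by ring.
      by apply: mulr_ge0; [exact: ltW | rewrite subr_ge0 lerNr].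
    apply: (@le_trans _ _ (expR (- (t * a)) * expR (- t * X 0 u))).
      by rewrite -expRD addrC -[leLHS]expR0 ler_expR.
    rewrite /G ler_wpM2l ?expR_ge0//.
    by have [] := ar4 _ _ _ (expR_ge0 (t * X 0 u)) (expR_ge0 (t * X 1 u))
      (expR_ge0 (- t * X 0 u)).
  have zn0 : 0 < n%:R :> RR by rewrite -zn exprn_gt0.
  have {}hu : z ^+ 5 < `|ln (opnorm (iterate B u)) - n%:R * L|.
    have -> : ln (opnorm (iterate B u)) - n%:R * L =
        n%:R * (n%:R^-1 * ln (opnorm (iterate B u)) - L).
      by rewrite mulrBr mulrA divff ?gt_eqF// mul1r.
    rewrite normrM gtr0_norm//.
    have -> : z ^+ 5 = n%:R * z^-1 by rewrite -zn; field; rewrite gt_eqF.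
    by rewrite ltr_pM2l.
  have [h1 [r h2]] := ln_opnorm_bounds u.
  have bd : 2 * D + 2 <= a by rewrite /a; lra.
  have ae : z ^+ 5 = a + a by rewrite /a; field.
  move: hu; rewrite ae ltr_normr => /orP[hu|hu].
    apply: (Gge r); have := hL n r; rewrite ler_norml => /andP[_ h3].
    exact: ar1 h2 hu h3 bd.
  apply: Gle; have := hL n 0; rewrite ler_norml => /andP[h3 _].
  exact: ar2 (h1 0) hu h3 bd.
apply: (le_lt_trans hPG); apply: (le_lt_trans EG).
have h16 : 16 <= z ^+ 2 / 2 - 2 * z by nra.
have e16 : 3 < expR (z ^+ 2 / 2 - 2 * z).
  by apply: lt_le_trans (expR_ge1Dx _); lra.
have -> : expR (- z) = expR (- (t * a)) * expR z * expR (z ^+ 2 / 2 - 2 * z).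
  by rewrite -!expRD ta; congr expR; field.
exact: ar3 e16 (expR_gt0 _) (expR_gt0 _).
Qed.

End LargeDeviations.

(** * Drift of a nearly diagonal cocycle *)

(** Used to choose small parameters explicitly as exponentials: [exp (- y)] lies below [c] as soon
    as [y >= 1 / c]. *)
Lemma expRN_inv_le (c : RR) : 0 < c -> expR (- c^-1) <= c.
Proof.
move=> c0; rewrite expRN -[leRHS]invrK lef_pV2 ?posrE ?expR_gt0 ?invr_gt0//.
by apply: le_trans (expR_ge1Dx _); rewrite lerDr.
Qed.

Lemma weight_ge k (p : 'I_k -> RR) (p0 : RR) (u : seq 'I_k) :
  0 <= p0 -> (forall j, p0 <= p j) -> p0 ^+ size u <= weight p u.
Proof.
move=> p00 h; elim: u => [|j u IH]; first by rewrite /weight big_nil.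
by rewrite /weight big_cons exprS ler_pM// exprn_ge0.
Qed.

(** The roles of the parameters: errors of size [eta] change one-step rates by factors within
    [exp (L / 4)]; [kap] bounds the norms of the matrices and their inverses. By [hq] the power [al]
    of [|y| / |x|] does not grow in mean, and [sg] is a floor for this ratio. By [hN], [N]
    applications of [B i] bring the ratio below [exp (- 1 / al)]. By [hR] the mean drop of the
    penalty [R] pays for [N + 1] steps of losing [ln kap] and still leaves growth [L / 2] per
    step. *)
Section Drift.
Variables (k : nat) (p a b : 'I_k -> RR) (L eta kap al zeta R sg p0 : RR) (N : nat).
Variables (B : cocycle k) (i j0 : 'I_k).
Hypotheses (hp : prob_vec p) (hab : forall j, `|a j| * `|b j| = 1)
  (hL : \sum_j p j * ln `|a j| = L) (L_gt0 : 0 < L)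
  (eta_a : forall j, 2 * eta <= (1 - expR (- (L / 4))) * `|a j|)
  (eta_b : forall j, 2 * eta <= (1 - expR (- (L / 4))) * `|b j|)
  (kap_ge1 : 1 <= kap)
  (kap_a : forall j, expR (L / 4) * `|a j| <= kap)
  (kap_b : forall j, expR (L / 4) * `|b j| <= kap)
  (al_gt0 : 0 < al)
  (hq : \sum_j p j * expR (al * (L / 2 - 2 * ln `|a j|)) <= 1)
  (sg_gt0 : 0 < sg) (sg_eta : sg <= eta) (sg_le1 : sg <= 1)
  (R_ge0 : 0 <= R) (R_sg : R * sg `^ al <= L / 4)
  (zeta_gt0 : 0 < zeta)
  (hN : expR (- L) ^+ N * (kap * (kap + 1) / zeta) + sg / (1 - expR (- L)) <= expR (- al^-1))
  (p0_gt0 : 0 < p0) (hp0 : forall j, p0 <= p j)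
  (hR : N.+1%:R * (ln kap + L / 2) <= R * (p0 ^+ N.+1 / 2))
  (hi : expR L <= `|a i|) (Bi01 : B i 0 1 = 0) (Bj01 : zeta <= `|B j0 0 1|)
  (hB00 : forall j, `|B j 0 0 - a j| <= eta) (hB11 : forall j, `|B j 1 1 - b j| <= eta)
  (hB01 : forall j, `|B j 0 1| <= eta) (hB10 : forall j, `|B j 1 0| <= sg ^+ 2).

Let a_gt0 j : 0 < `|a j|.
Proof.
rewrite lt_neqAle normr_ge0 andbT eq_sym; apply: contra_eq_neq (hab j) => ->.
by rewrite mul0r eq_sym oner_eq0.
Qed.

Let b_gt0 j : 0 < `|b j|.
Proof.
rewrite lt_neqAle normr_ge0 andbT eq_sym; apply: contra_eq_neq (hab j) => ->.
by rewrite mulr0 eq_sym oner_eq0.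
Qed.

Let E := expR (L / 4).
Let Ei := expR (- (L / 4)).

Let E_bd : [/\ 0 < Ei, Ei < 1, 1 < E, E * Ei = 1 & 2 - Ei <= E].
Proof.
have e1 : E * Ei = 1 by rewrite /E /Ei -expRD subrr expR0.
have e2 : 1 < E by rewrite /E expR_gt1; move: L_gt0; lra.
have e3 : 0 < Ei by exact: expR_gt0.
split => //; first by nra.
have := sqr_ge0 (E - 1); nra.
Qed.

Let a_lo j : Ei * `|a j| <= `|a j| - 2 * eta.
Proof. have := eta_a j; rewrite -/Ei; lra. Qed.
Let b_lo j : Ei * `|b j| <= `|b j| - 2 * eta.
Proof. have := eta_b j; rewrite -/Ei; lra. Qed.
Let a_up j : `|a j| + 2 * eta <= E * `|a j|.
Proof. have := eta_a j; rewrite -/Ei; have [_ _ _ _] := E_bd; have := a_gt0 j; nra. Qed.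
Let b_up j : `|b j| + 2 * eta <= E * `|b j|.
Proof. have := eta_b j; rewrite -/Ei; have [_ _ _ _] := E_bd; have := b_gt0 j; nra. Qed.

Let nB00 j : `|a j| - eta <= `|B j 0 0| <= `|a j| + eta.
Proof.
have h1 := ler_normD (B j 0 0 - a j) (a j); have h2 := ler_normD (a j - B j 0 0) (B j 0 0).
have h3 := hB00 j; move: h1 h2; rewrite !subrK [`|a j - _|]distrC => h1 h2.
apply/andP; split; lra.
Qed.

Let nB11 j : `|b j| - eta <= `|B j 1 1| <= `|b j| + eta.
Proof.
have h1 := ler_normD (B j 1 1 - b j) (b j); have h2 := ler_normD (b j - B j 1 1) (B j 1 1).
have h3 := hB11 j; move: h1 h2; rewrite !subrK [`|b j - _|]distrC => h1 h2.
apply/andP; split; lra.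
Qed.

Let nB10 j : `|B j 1 0| <= eta.
Proof. by apply: (le_trans (hB10 j)); move: sg_gt0 sg_eta sg_le1; nra. Qed.

Let eta_gt0 : 0 < eta. Proof. exact: lt_le_trans sg_eta. Qed.

Let xB_lo j v : `|v 1 0| <= `|v 0 0| -> Ei * `|a j| * `|v 0 0| <= `|(B j *m v) 0 0|.
Proof.
move=> h; rewrite mulmx2E; apply: le_trans (lerB_normD _ _); rewrite !normrM.
have /andP[h1 _] := nB00 j; have h2 := hB01 j; have h3 := a_lo j.
have h4 : `|B j 0 1| * `|v 1 0| <= eta * `|v 0 0| by apply: ler_pM.
have h5 : (Ei * `|a j| + eta) * `|v 0 0| <= `|B j 0 0| * `|v 0 0| by rewrite ler_wpM2r//; lra.
lra.
Qed.

Let yB_lo j v : `|v 0 0| <= `|v 1 0| -> Ei * `|b j| * `|v 1 0| <= `|(B j *m v) 1 0|.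
Proof.
move=> h; rewrite mulmx2E addrC; apply: le_trans (lerB_normD _ _); rewrite !normrM.
have /andP[h1 _] := nB11 j; have h2 := nB10 j; have h3 := b_lo j.
have h4 : `|B j 1 0| * `|v 0 0| <= eta * `|v 1 0| by apply: ler_pM.
have h5 : (Ei * `|b j| + eta) * `|v 1 0| <= `|B j 1 1| * `|v 1 0| by rewrite ler_wpM2r//; lra.
lra.
Qed.

(** The floor [sg <= r] absorbs the lower-left entry into the relative error, because
    [sg^2 <= eta * r]. *)
Let yB_up j v (r : RR) : `|v 1 0| <= r * `|v 0 0| -> sg <= r ->
  `|(B j *m v) 1 0| <= E * `|b j| * r * `|v 0 0|.
Proof.
move=> hr sr; rewrite mulmx2E; apply: (le_trans (ler_normD _ _)); rewrite !normrM.
have /andP[_ h1] := nB11 j; have h2 := hB10 j; have h3 := b_up j.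
have h4 : `|B j 1 1| * `|v 1 0| <= (`|b j| + eta) * (r * `|v 0 0|) by apply: ler_pM.
have h5 : `|B j 1 0| * `|v 0 0| <= eta * r * `|v 0 0|.
  by rewrite ler_wpM2r//; apply: (le_trans h2); rewrite expr2 ler_pM// ltW.
have h6 : (`|b j| + 2 * eta) * (r * `|v 0 0|) <= E * `|b j| * (r * `|v 0 0|).
  by rewrite ler_wpM2r// (le_trans _ hr).
lra.
Qed.

Let nmB_up j v : nm (B j *m v) <= kap * nm v.
Proof.
have n0 := nm_ge0 v; have e0 := eta_gt0; rewrite nm_le !mulmx2E; apply/andP; split.
- apply: (le_trans (ler_normD _ _)); rewrite !normrM.
  have /andP[_ h1] := nB00 j; have h3 := a_up j; have h4 := kap_a j.
  have h5 : `|B j 0 0| * `|v 0 0| <= (`|a j| + eta) * nm v by apply: ler_pM => //; exact: nm_coord.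
  have h6 : `|B j 0 1| * `|v 1 0| <= eta * nm v by apply: ler_pM => //; exact: nm_coord.
  have h7 : (`|a j| + 2 * eta) * nm v <= kap * nm v by rewrite ler_wpM2r// (le_trans h3).
  lra.
- apply: (le_trans (ler_normD _ _)); rewrite !normrM.
  have /andP[_ h1] := nB11 j; have h3 := b_up j; have h4 := kap_b j.
  have h5 : `|B j 1 1| * `|v 1 0| <= (`|b j| + eta) * nm v by apply: ler_pM => //; exact: nm_coord.
  have h6 : `|B j 1 0| * `|v 0 0| <= eta * nm v by apply: ler_pM => //; exact: nm_coord.
  have h7 : (`|b j| + 2 * eta) * nm v <= kap * nm v by rewrite ler_wpM2r// (le_trans h3).
  lra.
Qed.

Let nmB_lo j v : nm v <= kap * nm (B j *m v).
Proof.
have [e0 _ _ e1 _] := E_bd; have k0 : 0 <= kap by exact: le_trans kap_ge1.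
have key c d x y : 0 < c -> 0 <= x -> c * d = 1 -> E * d <= kap -> Ei * c * x <= y ->
    y <= nm (B j *m v) -> x <= kap * nm (B j *m v).
  move=> c0 x0 cd Ed h1 h2; apply: (@le_trans _ _ (kap * y)); last by rewrite ler_wpM2l.
  apply: (@le_trans _ _ (E * d * (Ei * c * x))).
    have -> : E * d * (Ei * c * x) = (E * Ei) * (c * d) * x by ring.
    by rewrite e1 cd !mul1r.
  by apply: ler_pM => //; rewrite ?mulr_ge0 ?expR_ge0// ?ltW//; nra.
case: (leP `|v 1 0| `|v 0 0|) => h.
  rewrite {1}/nm (max_idPl h); apply: (key `|a j| `|b j|) (xB_lo j h) _ => //.
  exact: nm_coord.
rewrite {1}/nm (max_idPr (ltW h)); apply: (key `|b j| `|a j|) (yB_lo j (ltW h)) _ => //.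
  by rewrite mulrC.
exact: nm_coord.
Qed.

Let B_neq0 j v : v != 0 -> B j *m v != 0.
Proof.
move=> /nm_gt0 v0; apply: nm0P; have := nmB_lo j v; have := nm_ge0 (B j *m v).
by move: kap_ge1; nra.
Qed.

Let iterB_neq0 (u : seq 'I_k) v : v != 0 -> iterate B u *m v != 0.
Proof.
elim: u v => [|j u IH] v v0; first by rewrite /iterate /= mul1mx.
by rewrite iterate_cons -mulmxA IH// B_neq0.
Qed.

Let lg_iter_lo (u : seq 'I_k) v : v != 0 ->
  ln (nm v) - (size u)%:R * ln kap <= ln (nm (iterate B u *m v)).
Proof.
elim: u v => [|j u IH] v v0; first by rewrite /iterate /= mul1mx mul0r subr0.
rewrite iterate_cons -mulmxA; apply: le_trans (IH _ (B_neq0 j v0)).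
rewrite [size _]/= -natr1 mulrDl mul1r.
have : ln (nm v) <= ln (kap * nm (B j *m v)).
  by rewrite ler_ln ?posrE ?mulr_gt0 ?nm_gt0 ?B_neq0//; exact: lt_le_trans kap_ge1.
rewrite lnM ?posrE ?nm_gt0 ?B_neq0//; last exact: lt_le_trans kap_ge1.
lra.
Qed.

(* [h] is 1 exactly on the cone where the contracted coordinate dominates; the penalty
   [R * h] pays for the time spent before leaving that cone. *)
Let h v : RR := (`|v 1 0| / nm v) `^ al.
Let U v : RR := ln (nm v) - R * h v.

Let h_ge0 v : 0 <= h v. Proof. exact: powR_ge0. Qed.

Let h_le v r : 0 <= r -> `|v 1 0| <= r * nm v -> h v <= r `^ al.
Proof.
move=> r0 hr; apply: ge0_ler_powR; rewrite ?nnegrE//; first exact: ltW.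
  by rewrite divr_ge0 ?nm_ge0.
have := nm_ge0 v; rewrite le_eqVlt => /predU1P[<-|n0]; first by rewrite invr0 mulr0.
by rewrite ler_pdivrMr.
Qed.

Let h_le1 v : h v <= 1.
Proof. by have := @h_le v 1 ler01; rewrite powR1 mul1r; apply; exact: nm_coord. Qed.

(** The log-norm gains [L - L / 4] in mean. The ratio, cut off below at [sg], is multiplied by at
    most [exp (L / 2 - 2 ln |a_j|)], so by [hq] the mean penalty is at most [R (h v + sg^al)], which
    is [R h v] plus at most another [L / 4]. *)
Lemma drift_outside v : v != 0 -> `|v 1 0| <= `|v 0 0| ->
  U v + L / 2 <= \sum_j p j * U (B j *m v).
Proof.
move=> v0 hv; have n0 := nm_gt0 v0.
have ar (x y z c r s t m : RR) : - x + y + z <= c -> s <= r * (t * m) ->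
  (z - x) + y - r * m * t <= c - s by lra.
have ar' (x y z r r' t : RR) : r' <= r -> r <= y * (z + t) -> y * t <= L / 4 ->
  (x - y * z) + L / 2 <= x - L / 4 + L - r' by lra.
have nE : nm v = `|v 0 0| by rewrite /nm (max_idPl hv).
have x0 : 0 < `|v 0 0| by rewrite -nE.
have [e0 _ _ e1 _] := E_bd.
pose M := Num.max (`|v 1 0| / `|v 0 0|) sg.
have M0 : 0 <= M by rewrite /M le_max (ltW sg_gt0) orbT.
pose q j := expR (al * (L / 2 - 2 * ln `|a j|)).
have hh j : h (B j *m v) <= q j * M `^ al.
  have -> : q j * M `^ al = (expR (L / 2 - 2 * ln `|a j|) * M) `^ al.
    by rewrite powRM ?expR_ge0// /q [al * _]mulrC expRM.
  apply: h_le; first by rewrite mulr_ge0 ?expR_ge0.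
  have h1 : `|(B j *m v) 1 0| <= E * `|b j| * M * `|v 0 0|.
    apply: yB_up; last by rewrite /M le_max lexx orbT.
    by rewrite -ler_pdivrMr// /M le_max lexx.
  apply: (le_trans h1).
  have h2 := le_trans (xB_lo j hv) (nm_coord _ 0).
  apply: le_trans (ler_wpM2l _ h2); last by rewrite mulr_ge0 ?expR_ge0.
  have -> : expR (L / 2 - 2 * ln `|a j|) = E * E * (`|b j| * `|b j|).
    have bE : `|b j| = `|a j|^-1.
      by apply: (mulfI (lt0r_neq0 (a_gt0 j))); rewrite hab divff// lt0r_neq0.
    have -> : L / 2 - 2 * ln `|a j| = (L / 4 + L / 4) + (- ln `|a j| + - ln `|a j|) by field.
    by rewrite !expRD expRN lnK ?posrE// bE.
  have -> : E * E * (`|b j| * `|b j|) * M * (Ei * `|a j| * `|v 0 0|) =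
    (E * Ei) * (`|a j| * `|b j|) * (E * `|b j| * M * `|v 0 0|) by ring.
  by rewrite e1 hab !mul1r.
have hM : M `^ al <= h v + sg `^ al.
  rewrite /h nE /M; case: (leP (`|v 1 0| / `|v 0 0|) sg) => _.
    by rewrite lerDr powR_ge0.
  by rewrite lerDl powR_ge0.
have hU j : (ln (nm v) - L / 4) + ln `|a j| - R * M `^ al * q j <= U (B j *m v).
  have h1 : ln (Ei * `|a j| * nm v) <= ln (nm (B j *m v)).
    rewrite ler_ln ?posrE ?mulr_gt0 ?nm_gt0 ?B_neq0//.
    by rewrite nE; apply: (le_trans (xB_lo j hv)); exact: nm_coord.
  have h2 : R * h (B j *m v) <= R * (q j * M `^ al) by rewrite ler_wpM2l.
  by move: h1; rewrite !lnM ?posrE ?mulr_gt0// /Ei expRK => h1; exact: ar h1 h2.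
apply: (@le_trans _ _ (\sum_j p j * ((ln (nm v) - L / 4) + ln `|a j| - R * M `^ al * q j))).
  rewrite (eq_bigr (fun j => p j * (ln (nm v) - L / 4) + p j * ln `|a j|
    - R * M `^ al * (p j * q j))); last by move=> j _; ring.
  rewrite sumrB big_split/= -big_distrl -big_distrr/= hp.2 hL mul1r.
  have h1 : R * M `^ al * \sum_j p j * q j <= R * M `^ al.
    by rewrite -[leRHS]mulr1 ler_wpM2l ?mulr_ge0 ?powR_ge0.
  have h2 : R * M `^ al <= R * (h v + sg `^ al) by rewrite ler_wpM2l.
  exact: ar' h1 h2 R_sg.
by apply: ler_sum => j _; rewrite ler_wpM2l// ltW// hp.1.
Qed.

Let th := expR (- L).
(** The ratio [|y| / |x|] guaranteed after the first letter of the escape word. *)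
Let Qr := kap * (kap + 1) / zeta.

Let th_bd : 0 < th < 1.
Proof. by rewrite expR_gt0 /= /th -expR0 ltr_expR; move: L_gt0; lra. Qed.

Let ratio_ge0 n : 0 <= th ^+ n * Qr + sg / (1 - th).
Proof.
have /andP[t0 t1] := th_bd; have k0 : 0 <= kap by exact: le_trans kap_ge1.
apply: addr_ge0; last by rewrite divr_ge0// ?subr_ge0; exact: ltW.
apply: mulr_ge0; first by rewrite exprn_ge0// ltW.
by rewrite /Qr divr_ge0 ?mulr_ge0 ?addr_ge0// ltW.
Qed.

(** As [B i 0 1 = 0], the first coordinate expands by at least [exp (3 L / 4)] even inside the cone,
    while the second contracts by that factor up to a term [sg |x|]. The ratio thus evolves under
    [r -> th r + sg], whose fixed point is [sg / (1 - th)]. *)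
Let ratio_iter n v : 0 < `|v 0 0| -> `|v 1 0| <= Qr * `|v 0 0| ->
  0 < `|(iterate B (nseq n i) *m v) 0 0| /\
  `|(iterate B (nseq n i) *m v) 1 0| <=
    (th ^+ n * Qr + sg / (1 - th)) * `|(iterate B (nseq n i) *m v) 0 0|.
Proof.
have /andP[t0 t1] := th_bd.
move=> v0 v1; elim: n => [|n [IH1 IH2]].
  rewrite /iterate /= mul1mx expr0 mul1r; split=> //; apply: (le_trans v1).
  by rewrite ler_wpM2r// lerDl divr_ge0 ?ltW// subr_gt0.
have -> : nseq n.+1 i = nseq n i ++ [:: i] by rewrite -addn1 nseqD.
rewrite iterate_cat {1 3 5}/iterate /= mulmx1 -!mulmxA.
move: IH1 IH2; set x := iterate _ _ *m v; set M := _ + _ => IH1 IH2.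
have M0 : 0 <= M by exact: ratio_ge0.
have -> : th ^+ n.+1 * Qr + sg / (1 - th) = th * M + sg.
  by rewrite /M exprS; field; rewrite subr_eq0 gt_eqF.
have f0 : 0 < expR (- (3 * L / 4)) by exact: expR_gt0.
pose f := expR (- (3 * L / 4)); pose g := expR (3 * L / 4).
have fg : f * g = 1 by rewrite /f /g -expRD addrC subrr expR0.
have ff : f * f <= th by rewrite /f /th -expRD ler_expR; move: L_gt0; lra.
have f1 : f <= 1 by rewrite /f -[leRHS]expR0 ler_expR; move: L_gt0; lra.
have x_lo : g * `|x 0 0| <= `|(B i *m x) 0 0|.
  rewrite mulmx2E Bi01 mul0r addr0 normrM ler_wpM2r//.
  have /andP[h1 _] := nB00 i; have h2 := a_lo i; have h3 := eta_gt0.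
  have : g <= Ei * `|a i|.
    have -> : g = Ei * expR L by rewrite /g /Ei -expRD; congr expR; field.
    by rewrite ler_wpM2l ?expR_ge0.
  lra.
have g0 : 0 < g by exact: expR_gt0.
split; first by apply: lt_le_trans x_lo; rewrite mulr_gt0.
have b_le : E * `|b i| <= f.
  have -> : f = E * expR (- L) by rewrite /f /E -expRD; congr expR; field.
  rewrite ler_wpM2l ?expR_ge0// expRN -[leRHS]mul1r ler_pdivlMr ?expR_gt0//.
  by rewrite -(hab i) [leRHS]mulrC; apply: ler_wpM2l.
have y_up : `|(B i *m x) 1 0| <= (f * M + sg) * `|x 0 0|.
  rewrite mulmx2E addrC; apply: (le_trans (ler_normD _ _)); rewrite !normrM mulrDl.
  apply: lerD.
    rewrite -mulrA; apply: ler_pM => //; apply: le_trans b_le.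
    by have /andP[_ h1] := nB11 i; have h2 := b_up i; have h3 := eta_gt0; lra.
  rewrite ler_wpM2r//; apply: (le_trans (hB10 i)).
  by rewrite expr2 -[leRHS]mul1r ler_wpM2r// ltW.
apply: (le_trans y_up).
have h1 : `|x 0 0| <= f * `|(B i *m x) 0 0|.
  rewrite -[leLHS]mul1r -fg -mulrA ler_wpM2l// ltW//.
apply: (@le_trans _ _ ((f * M + sg) * (f * `|(B i *m x) 0 0|))).
  by rewrite ler_wpM2l// addr_ge0 ?mulr_ge0// ltW.
rewrite mulrA ler_wpM2r//.
have : f * f * M <= th * M by rewrite ler_wpM2r.
have : sg * f <= sg by rewrite -[leRHS]mulr1 ler_wpM2l// ltW.
lra.
Qed.

(** The first letter produces a definite first coordinate: [i] if there is one already, otherwise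
    [j0], whose entry feeds the second coordinate into the first. Then [N] letters [i] bring the
    ratio below [exp (- 1 / al)], where [h <= 1 / e <= 1 / 2]. *)
Let escape_word v : v != 0 -> `|v 0 0| < `|v 1 0| ->
  exists2 u : seq 'I_k, size u = N.+1 & h (iterate B u *m v) <= 1 - 2^-1.
Proof.
move=> v0 hv; have y0 : 0 < `|v 1 0| by exact: le_lt_trans hv.
have nE : nm v = `|v 1 0| by rewrite /nm (max_idPr (ltW hv)).
have k1 : 0 < kap + 1 by move: kap_ge1; lra.
(* This threshold balances both cases: [zeta - kap ze = ze]. *)
pose ze := zeta / (kap + 1).
have ze0 : 0 < ze by rewrite divr_gt0.
have [s hs] : exists s, ze * `|v 1 0| <= `|(B s *m v) 0 0|.
  case: (leP (ze * `|v 1 0|) `|v 0 0|) => hz.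
    exists i; apply: (le_trans hz).
    rewrite mulmx2E Bi01 mul0r addr0 normrM -[leLHS]mul1r ler_wpM2r//.
    have /andP[h1 _] := nB00 i; have h2 := a_lo i; have h3 := eta_gt0.
    have : 1 <= Ei * `|a i|.
      apply: (@le_trans _ _ (Ei * expR L)); last by rewrite ler_wpM2l ?expR_ge0.
      by rewrite /Ei -expRD -[leLHS]expR0 ler_expR; move: L_gt0; lra.
    lra.
  exists j0; rewrite mulmx2E addrC; apply: le_trans (lerB_normD _ _); rewrite !normrM.
  have h1 : `|B j0 0 0| <= kap.
    have /andP[_ h1] := nB00 j0; have h2 := a_up j0; have h3 := eta_gt0; have := kap_a j0.
    rewrite -/E; lra.
  have h2 : `|B j0 0 0| * `|v 0 0| <= kap * (ze * `|v 1 0|) by apply: ler_pM => //; exact: ltW.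
  have h3 : zeta * `|v 1 0| <= `|B j0 0 1| * `|v 1 0| by rewrite ler_wpM2r.
  have ez : zeta = (kap + 1) * ze by rewrite /ze mulrC divfK// gt_eqF.
  move: h3; rewrite ez; lra.
exists (s :: nseq N i); first by rewrite /= size_nseq.
rewrite iterate_cons -mulmxA.
have x0 : 0 < `|(B s *m v) 0 0| by apply: lt_le_trans hs; rewrite mulr_gt0.
have x1 : `|(B s *m v) 1 0| <= Qr * `|(B s *m v) 0 0|.
  apply: (@le_trans _ _ (kap * `|v 1 0|)).
    by rewrite -nE; apply: le_trans (nmB_up s v); exact: nm_coord.
  have -> : Qr = kap / ze by rewrite /Qr /ze invfM invrK mulrA mulrAC.
  rewrite -mulrA ler_wpM2l//; first exact: le_trans kap_ge1.
  by rewrite mulrC ler_pdivlMr// mulrC.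
have [_ h2] := ratio_iter N x0 x1.
apply: (@le_trans _ _ (expR (- al^-1) `^ al)).
  apply: h_le; first exact: expR_ge0.
  apply: (le_trans h2); apply: ler_pM; [exact: ratio_ge0 | exact: normr_ge0 | exact: hN |].
  exact: nm_coord.
rewrite -expRM mulNr mulVf ?gt_eqF// expRN.
have e2 : 2 <= expR 1 :> RR by have := expR_ge1Dx (1 : RR).
have : (expR 1)^-1 <= 2^-1 :> RR by rewrite lef_pV2 ?posrE ?expR_gt0.
lra.
Qed.

(** Inside the cone the penalty is maximal. The escape word has probability at least [p0^(N+1)] and
    lowers [h] by one half, and [hR] makes this outweigh the worst loss of norm. *)
Lemma drift_inside v : v != 0 -> `|v 0 0| < `|v 1 0| ->
  U v + L / 2 * N.+1%:R <= Ex p N.+1 (fun u => U (iterate B u *m v)).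
Proof.
move=> v0 hv; have [u0 su hu] := escape_word v0 hv.
have ar (x y c n d P : RR) : c - n * d <= x -> R * y <= R * (1 - P) ->
  n * (d + L / 2) <= R * P -> c - R * 1 + L / 2 * n <= x - R * y by lra.
have hv1 : h v = 1.
  by rewrite /h /nm (max_idPr (ltW hv)) divff ?powR1// gt_eqF// (le_lt_trans _ hv).
rewrite /U hv1 Ex_sub Ex_scale.
have h1 : ln (nm v) - N.+1%:R * ln kap <= Ex p N.+1 (fun u => ln (nm (iterate B u *m v))).
  by apply: Ex_ge => // u <-; exact: lg_iter_lo.
have h2 : Ex p N.+1 (fun u => h (iterate B u *m v)) <= 1 - p0 ^+ N.+1 / 2.
  rewrite -su; apply: (le_trans (Ex_le1_word hp _ hu)); first by move=> u _; exact: h_le1.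
  by rewrite lerD2l lerN2 ler_wpM2r// weight_ge// ltW.
have h3 := ler_wpM2l R_ge0 h2.
exact: ar h1 h3 hR.
Qed.

(** Strong induction on [m] by blocks whose length depends on the current vector: one step outside
    the cone, [N + 1] steps inside. An incomplete last block accounts for the term in [N + 1], and
    exchanging [U] with the log-norm at the end for the second [R]. *)
Lemma drift_growth m v : v != 0 ->
  ln (nm v) + L / 2 * m%:R - (2 * R + N.+1%:R * (ln kap + L / 2)) <=
  Ex p m (fun u => ln (nm (iterate B u *m v))).
Proof.
move=> v0.
have lk : 0 <= ln kap by exact: ln_ge0.
have hU x : ln (nm x) - R <= U x.
  by rewrite /U lerD2l lerN2 -[leRHS]mulr1 ler_wpM2l// h_le1.
have UU x : U x <= ln (nm x) by rewrite /U gerBl mulr_ge0// h_ge0.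
have key : U v + L / 2 * m%:R - N.+1%:R * (ln kap + L / 2) - R <=
    Ex p m (fun u => U (iterate B u *m v)).
  elim/ltn_ind: m v v0 => m IH v v0.
  have block t : (0 < t <= m)%N ->
      U v + L / 2 * t%:R <= Ex p t (fun u => U (iterate B u *m v)) ->
      U v + L / 2 * m%:R - N.+1%:R * (ln kap + L / 2) - R <=
      Ex p m (fun u => U (iterate B u *m v)).
    move=> /andP[t0 tm] ht; rewrite -{2}(subnKC tm) Ex_cat.
    apply: (@le_trans _ _ (Ex p t (fun u => U (iterate B u *m v) +
      (L / 2 * (m - t)%:R - N.+1%:R * (ln kap + L / 2) - R)))).
      rewrite Ex_add Ex_const// natrB//; lra.
    apply: (le_Ex hp) => u _.
    have lt : (m - t < m)%N by rewrite ltn_subrL t0 (leq_trans t0 tm).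
    have -> : Ex p (m - t) (fun x => U (iterate B (u ++ x) *m v)) =
        Ex p (m - t) (fun x => U (iterate B x *m (iterate B u *m v))).
      by apply: eq_Ex => x _; rewrite iterate_cat mulmxA.
    by apply: le_trans (IH (m - t)%N lt _ (iterB_neq0 u v0)); rewrite !addrA.
  case: (leP `|v 1 0| `|v 0 0|) => hv.
    case: (posnP m) => [->|m0].
      rewrite /= /iterate /= mul1mx mulr0 addr0.
      have : 0 <= N.+1%:R * (ln kap + L / 2) by rewrite mulr_ge0// addr_ge0// divr_ge0// ltW.
      move: R_ge0; lra.
    apply: (block 1%N); first by rewrite m0.
    rewrite mulr1; apply: (le_trans (drift_outside v0 hv)); rewrite /=.
    by apply: ler_sum => j _; rewrite /iterate /= mulmx1.
  case: (leqP N.+1 m) => hm; first by apply: (block N.+1) => //; exact: drift_inside.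
  apply: (@le_trans _ _ (ln (nm v) - m%:R * ln kap - R)).
    have mN : m%:R <= N.+1%:R :> RR by rewrite ler_nat ltnW.
    have h1 : m%:R * (ln kap + L / 2) <= N.+1%:R * (ln kap + L / 2).
      by rewrite ler_wpM2r// addr_ge0// divr_ge0// ltW.
    have h2 : 0 <= m%:R * ln kap by rewrite mulr_ge0.
    have h3 := UU v; lra.
  apply: Ex_ge => // u su; apply: le_trans (hU _).
  by rewrite lerD2r -su; exact: lg_iter_lo.
apply: (@le_trans _ _ (Ex p m (fun u => U (iterate B u *m v)))); last exact: le_Ex.
by apply: le_trans key; have := hU v; lra.
Qed.
End Drift.

(** The order of the quantifiers matters: [eta] is fixed before [zeta], and [eps] and [C] depend
    only on these and on the diagonal data. The rescaled cocycles then have growth constants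
    independent of [rho_-(B)]. Inside, the choices are made in the order [al], [N], [R], [sg]. *)
Lemma uniform_growth (k : nat) (p a b : 'I_k -> RR) (L : RR) :
  prob_vec p -> (forall j, `|a j| * `|b j| = 1) ->
  \sum_j p j * ln `|a j| = L -> 0 < L ->
  exists2 eta : RR, 0 < eta & forall zeta : RR, 0 < zeta ->
    exists2 eps : RR, 0 < eps & exists C : RR,
    forall (B : cocycle k) (i j0 : 'I_k), expR L <= `|a i| ->
      B i 0 1 = 0 -> zeta <= `|B j0 0 1| ->
      (forall j, `|B j 0 0 - a j| <= eta) -> (forall j, `|B j 1 1 - b j| <= eta) ->
      (forall j, `|B j 0 1| <= eta) -> (forall j, `|B j 1 0| <= eps) ->
      forall m v, v != 0 ->
        ln (nm v) + L / 2 * m%:R - C <= Ex p m (fun u => ln (nm (iterate B u *m v))).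
Proof.
move=> hp hab hL L0.
have [Ca Ca1 hCa] := fin_ubound a; have [Cb Cb1 hCb] := fin_ubound b.
pose C0 := Ca + Cb.
have C01 : 1 <= C0 by rewrite /C0; lra.
have aC j : `|a j| <= C0 by apply: (le_trans (hCa j)); rewrite /C0; lra.
have bC j : `|b j| <= C0 by apply: (le_trans (hCb j)); rewrite /C0; lra.
have aV j : C0^-1 <= `|a j|.
  rewrite -[leLHS]mul1r ler_pdivrMr; last by lra.
  by rewrite -(hab j) ler_wpM2l.
have bV j : C0^-1 <= `|b j|.
  rewrite -[leLHS]mul1r ler_pdivrMr; last by lra.
  by rewrite -(hab j) mulrC ler_wpM2l.
have Ei1 : 0 < 1 - expR (- (L / 4)) by rewrite subr_gt0 -[ltRHS]expR0 ltr_expR; lra.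
pose eta := (1 - expR (- (L / 4))) / C0 / 2.
have C0V : 0 < C0^-1 by rewrite invr_gt0; lra.
have eta0 : 0 < eta by rewrite /eta !divr_gt0//; lra.
have e2 : 2 * eta = (1 - expR (- (L / 4))) * C0^-1 by rewrite /eta; field; rewrite gt_eqF//; lra.
exists eta => // zeta zeta0.
pose kap := expR (L / 4) * C0.
have E1 : 1 <= expR (L / 4) by rewrite -[leLHS]expR0 ler_expR; lra.
have kap1 : 1 <= kap by rewrite /kap; nra.
have [Z Z1 hZ] := fin_ubound (fun j => L / 2 - 2 * ln `|a j|).
(* The exponent [al = 1 / Y] satisfies [al Z <= 1 / 2] and [2 al Z^2 <= L]. In [hq] the mean linear
   term is [- 3 al L / 2], which then dominates the quadratic term, at most [al L]. *)
pose Y := 2 * Z + 2 * Z ^+ 2 / L.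
have ZL : 0 < 2 * Z ^+ 2 / L by rewrite !(divr_gt0, mulr_gt0, exprn_gt0)//; lra.
have Y0 : 0 < Y by rewrite /Y; lra.
pose al := Y^-1.
have al0 : 0 < al by rewrite invr_gt0.
have alY : al * Y = 1 by rewrite mulVf// gt_eqF.
have alZ : al * Z <= 2^-1.
  have : 0 < al * (2 * Z ^+ 2 / L) by rewrite mulr_gt0.
  move: alY; rewrite /Y; lra.
have alZ2 : 2 * al * Z ^+ 2 <= L.
  have -> : 2 * al * Z ^+ 2 = L * (al * (2 * Z ^+ 2 / L)) by field; rewrite gt_eqF.
  rewrite -[leRHS]mulr1 ler_wpM2l ?(ltW L0)//.
  have : 0 < al * Z by rewrite mulr_gt0//; lra.
  move: alY; rewrite /Y; lra.
have hq : \sum_j p j * expR (al * (L / 2 - 2 * ln `|a j|)) <= 1.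
  apply: (@le_trans _ _ (\sum_j (p j * (1 + al * (L / 2) + 2 * al ^+ 2 * Z ^+ 2)
      - 2 * al * (p j * ln `|a j|)))).
    apply: ler_sum => j _; set x := L / 2 - 2 * ln `|a j|.
    have hx : `|x| <= Z by exact: hZ.
    have alx : al * x <= 2^-1.
      apply: le_trans alZ; rewrite ler_wpM2l ?(ltW al0)//; exact: le_trans (ler_norm _) hx.
    have x2 : x ^+ 2 <= Z ^+ 2.
      by rewrite -[leLHS]real_normK ?num_real// lerXn2r ?nnegrE// (le_trans _ hx).
    have h1 := expR_le_quad alx.
    have h2 : al ^+ 2 * x ^+ 2 <= al ^+ 2 * Z ^+ 2 by rewrite ler_wpM2l ?sqr_ge0.
    have h3 : expR (al * x) <= 1 + al * x + 2 * (al ^+ 2 * Z ^+ 2).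
      by apply: (le_trans h1); rewrite exprMn; lra.
    have := ler_wpM2l (ltW (hp.1 j)) h3; rewrite {2}/x; lra.
  rewrite sumrB -big_distrl -big_distrr/= hp.2 hL mul1r.
  have : al * (2 * al * Z ^+ 2) <= al * L by rewrite ler_wpM2l// ltW.
  have : 0 < al * L by rewrite mulr_gt0.
  rewrite expr2; lra.
have [Cp Cp1 hCp] := fin_ubound (fun j => (p j)^-1).
pose p0 := Cp^-1.
have p00 : 0 < p0 by rewrite invr_gt0; lra.
have hp0 j : p0 <= p j.
  rewrite /p0 -[leRHS]invrK lef_pV2 ?posrE ?invr_gt0 ?hp.1//; last by lra.
  exact: le_trans (ler_norm _) (hCp j).
pose tau := expR (- al^-1).
have tau0 : 0 < tau by exact: expR_gt0.
pose Qr := kap * (kap + 1) / zeta.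
have Qr0 : 0 < Qr by rewrite /Qr divr_gt0// mulr_gt0//; lra.
pose cN := tau / 2 / Qr.
have cN0 : 0 < cN by apply: divr_gt0 => //; apply: divr_gt0.
have [N hN1] : exists N : nat, expR (- L) ^+ N * Qr <= tau / 2.
  exists (Num.truncn (cN^-1 / L)).+1; rewrite -ler_pdivlMr// -expRM_natr.
  apply: le_trans (expRN_inv_le cN0).
  rewrite ler_expR mulNr lerN2 mulrC -ler_pdivrMr//; exact/ltW/truncnS_gt.
have lk : 0 <= ln kap by exact: ln_ge0.
have pN : 0 < p0 ^+ N.+1 / 2 by rewrite divr_gt0// exprn_gt0.
have lkL : 0 <= ln kap + L / 2 by lra.
have [R R0 hR] : exists2 R : RR, 0 <= R &
    N.+1%:R * (ln kap + L / 2) <= R * (p0 ^+ N.+1 / 2).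
  exists (N.+1%:R * (ln kap + L / 2) / (p0 ^+ N.+1 / 2)); last by rewrite divfK// gt_eqF.
  by apply: divr_ge0; [exact: mulr_ge0 | exact: ltW].
have th1 : 0 < 1 - expR (- L) by rewrite subr_gt0 -[ltRHS]expR0 ltr_expR; lra.
pose c2 := L / 4 / (R + 1); pose c3 := tau / 2 * (1 - expR (- L)).
have c20 : 0 < c2 by rewrite /c2 !divr_gt0//; lra.
have c30 : 0 < c3 by rewrite /c3 mulr_gt0// divr_gt0.
(* Each summand serves one smallness condition on [sg = exp (- y)]: [sg <= eta], [sg^al <= c2] and
   [sg <= c3]. *)
pose y := eta^-1 + c2^-1 / al + c3^-1.
have y1 : 0 < eta^-1 by rewrite invr_gt0.
have y2 : 0 < c2^-1 / al by rewrite divr_gt0// invr_gt0.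
have y3 : 0 < c3^-1 by rewrite invr_gt0.
pose sg := expR (- y).
have sg0 : 0 < sg by exact: expR_gt0.
have sg_eta : sg <= eta.
  by apply: le_trans (expRN_inv_le eta0); rewrite ler_expR /y; lra.
have sg1 : sg <= 1 by rewrite /sg -[leRHS]expR0 ler_expR /y; lra.
have sg3 : sg <= c3.
  by apply: le_trans (expRN_inv_le c30); rewrite ler_expR /y; lra.
have sg2 : sg `^ al <= c2.
  rewrite /sg -expRM; apply: le_trans (expRN_inv_le c20); rewrite ler_expR mulNr lerN2.
  by rewrite -ler_pdivrMr// /y; lra.
have R_sg : R * sg `^ al <= L / 4.
  apply: (@le_trans _ _ ((R + 1) * c2)).
    by apply: ler_pM => //; [exact: powR_ge0 | lra].
  by rewrite /c2 mulrC divfK// gt_eqF//; lra.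
have hN : expR (- L) ^+ N * (kap * (kap + 1) / zeta) + sg / (1 - expR (- L)) <= expR (- al^-1).
  have : sg / (1 - expR (- L)) <= tau / 2 by rewrite ler_pdivrMr.
  move: hN1; rewrite -/Qr -/tau; lra.
exists (sg ^+ 2); first by rewrite exprn_gt0.
exists (2 * R + N.+1%:R * (ln kap + L / 2)) => B i j0 hi Bi Bj hB00 hB11 hB01 hB10 m v v0.
apply: (@drift_growth k p a b L eta kap al zeta R sg p0 N B i j0) => //.
- by move=> j; rewrite e2; apply: ler_wpM2l => //; exact: ltW.
- by move=> j; rewrite e2; apply: ler_wpM2l => //; exact: ltW.
- by move=> j; rewrite /kap ler_wpM2l ?expR_ge0.
- by move=> j; rewrite /kap ler_wpM2l ?expR_ge0.
Qed.

(** * Hyperbolicity of matrices near a diagonal one *)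

Lemma kernel2 (g : 'M[RR]_2) : \det g = 0 -> exists2 v : 'cV[RR]_2, v != 0 & g *m v = 0.
Proof.
rewrite -det_tr => /eqP/det0P[v v0 hv]; exists v^T.
  by apply: contra v0 => /eqP h; rewrite -[v]trmxK h trmx0.
by rewrite -[g]trmxK -trmx_mul hv trmx0.
Qed.

Lemma eigvec_root (g : 'M[RR]_2) (x : RR) :
  x ^+ 2 - (g 0 0 + g 1 1) * x + \det g = 0 -> exists v, eigvec g x v.
Proof.
move=> h; have [|v v0 hv] := @kernel2 (g - x%:M).
  by rewrite det2E !mxE /= mulr1n mulr0n -[RHS]h det2E; ring.
by exists v; split=> //; apply/eqP; rewrite -subr_eq0 -mul_scalar_mx -mulmxBl hv.
Qed.

(** A positive discriminant gives two distinct real roots and a nonzero trace excludes opposite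
    ones, so their moduli differ. Their product has modulus 1, hence 1 lies strictly between the
    moduli. *)
Lemma hyperbolic_trace (g : 'M[RR]_2) : inSL g -> g 0 0 + g 1 1 != 0 ->
  4 * \det g < (g 0 0 + g 1 1) ^+ 2 -> hyperbolic g.
Proof.
set t := g 0 0 + g 1 1; move=> hg t0 disc.
pose s := Num.sqrt (t ^+ 2 - 4 * \det g).
have s0 : 0 < s by rewrite sqrtr_gt0 subr_gt0.
have s2 : s ^+ 2 = t ^+ 2 - 4 * \det g by rewrite sqr_sqrtr// subr_ge0 ltW.
pose x := (t + s) / 2; pose y := (t - s) / 2.
have ex : exists v, eigvec g x v.
  apply: eigvec_root; rewrite -/t.
  have -> : \det g = (t ^+ 2 - s ^+ 2) / 4 by rewrite s2; field.
  by rewrite /x; field.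
have ey : exists v, eigvec g y v.
  apply: eigvec_root; rewrite -/t.
  have -> : \det g = (t ^+ 2 - s ^+ 2) / 4 by rewrite s2; field.
  by rewrite /y; field.
have xy : `|x| * `|y| = 1.
  rewrite -normrM; have -> : x * y = \det g.
    have -> : \det g = (t ^+ 2 - s ^+ 2) / 4 by rewrite s2; field.
    by rewrite /x /y; field.
  by case: hg => ->; rewrite ?normrN normr1.
have ne : `|x| != `|y|.
  apply/eqP => /eqP; rewrite eqr_norm2; apply/negP; rewrite negb_or; apply/andP; split.
    by apply/eqP; rewrite /x /y => h; move: s0; lra.
  by apply: contraNneq t0; rewrite /x /y => h; apply/eqP; lra.
have y0 := normr_ge0 y; have x0 := normr_ge0 x.
case: (ltgtP `|x| `|y|) ne => // h _.
  by exists y, x; split; [nra | split; [nra | split]].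
by exists x, y; split; [nra | split; [nra | split]].
Qed.

(* With [|a b| = 1], the discriminant of [diag(a, b)] is [(|a| - |b|)^2] or larger. *)
Lemma hyperbolic_near_diag (g : 'M[RR]_2) (a b L C d : RR) : inSL g -> 0 < L ->
  expR L <= `|a| -> a * b = 1 \/ a * b = -1 -> `|a| <= C -> `|b| <= C ->
  `|g 0 0 - a| <= d -> `|g 1 1 - b| <= d -> `|g 0 1| <= d -> `|g 1 0| <= d ->
  d <= 1 -> 4 * d < L -> 8 * C * d < L ^+ 2 -> (2 * C + 2) * d < 1 -> hyperbolic g.
Proof.
move=> hg L0 ha hab aC bC h00 h11 h01 h10 d1 dL dL2 dC.
have d0 : 0 <= d by exact: le_trans (normr_ge0 _) h00.
have nab : `|a| * `|b| = 1 by rewrite -normrM; case: hab => ->; rewrite ?normrN normr1.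
have aL : 1 + L <= `|a| by apply: le_trans ha; exact: expR_ge1Dx.
have b1 : `|b| < 1 by have := normr_ge0 b; nra.
(* Both sides are 1 or -1, so a distance less than 2 forces equality. *)
have deq : \det g = a * b.
  have : `|\det g - a * b| < 2.
    have -> : \det g - a * b = (g 0 0 - a) * (g 1 1 - b) + a * (g 1 1 - b) + b * (g 0 0 - a)
       - g 0 1 * g 1 0 by rewrite det2E; ring.
    have n1 : `|(g 0 0 - a) * (g 1 1 - b)| <= d * d by rewrite normrM ler_pM.
    have n2 : `|a * (g 1 1 - b)| <= C * d by rewrite normrM ler_pM.
    have n3 : `|b * (g 0 0 - a)| <= C * d by rewrite normrM ler_pM.
    have n4 : `|g 0 1 * g 1 0| <= d * d by rewrite normrM ler_pM.
    move: n1 n2 n3 n4; rewrite !ler_norml => /andP[? ?] /andP[? ?] /andP[? ?] /andP[? ?].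
    by rewrite ltr_norml; apply/andP; split; nra.
  by rewrite ltr_norml; case: hg => ->; case: hab => -> // /andP[]; lra.
set t := g 0 0 + g 1 1.
have ht : `|t - (a + b)| <= 2 * d.
  move: h00 h11; rewrite /t !ler_norml => /andP[? ?] /andP[? ?]; apply/andP; split; lra.
have hs : L <= `|a + b|.
  by have := lerB_normD a b; lra.
have ht2 : `|a + b| - 2 * d <= `|t|.
  by have := ler_normB t (t - (a + b)); rewrite opprB addrC subrK; lra.
have t0 : 0 < `|t| by lra.
apply: hyperbolic_trace => //; first by rewrite -/t -normr_gt0.
rewrite -/t deq -[t ^+ 2]real_normK ?num_real//.
case: hab => e; rewrite e; last by have := sqr_ge0 `|t|; nra.
have sab : `|a + b| ^+ 2 = (`|a| - `|b|) ^+ 2 + 4.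
  rewrite real_normK ?num_real//.
  have -> : (`|a| - `|b|) ^+ 2 = `|a| ^+ 2 - 2 * (`|a| * `|b|) + `|b| ^+ 2 by ring.
  rewrite nab !real_normK ?num_real//.
  have -> : (a + b) ^+ 2 = a ^+ 2 + 2 * (a * b) + b ^+ 2 by ring.
  by rewrite e; ring.
have hab2 : L ^+ 2 <= (`|a| - `|b|) ^+ 2 by rewrite lerXn2r ?nnegrE//; lra.
have sC : `|a + b| <= 2 * C by have := ler_normD a b; lra.
nra.
Qed.

(** * Adapted coordinates *)

(** Positivity excludes the default value 0 of the maximum. *)
Lemma bigmax_attained (I : finType) (P : pred I) (F : I -> RR) :
  0 < \big[Num.max/0]_(i | P i) F i ->
  exists2 i, P i & \big[Num.max/0]_(i | P i) F i = F i.
Proof.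
have : \big[Num.max/0]_(i | P i) F i = 0 \/
    exists2 i, P i & \big[Num.max/0]_(i | P i) F i = F i.
  apply: (big_ind (fun x => x = 0 \/ exists2 i, P i & x = F i)); first by left.
    by move=> x y hx hy; case: (leP x y).
  by move=> i Pi; right; exists i.
by case=> [->|//]; rewrite ltxx.
Qed.

Definition mx2 (a b c d : RR) : 'M[RR]_2 :=
  \matrix_(r, s) (if r == 0 then (if s == 0 then a else b) else (if s == 0 then c else d)).

Lemma eq_mx2 (g h : 'M[RR]_2) : g 0 0 = h 0 0 -> g 0 1 = h 0 1 -> g 1 0 = h 1 0 ->
  g 1 1 = h 1 1 -> g = h.
Proof.
by move=> *; apply/matrixP => r s; case: (ord2P r) => ->; case: (ord2P s) => ->.
Qed.

Lemma entry_mul_le (g h : 'M[RR]_2) (c d : RR) : (forall r s, `|g r s| <= c) ->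
  (forall r s, `|h r s| <= d) -> forall r s, `|(g *m h) r s| <= 2 * c * d.
Proof.
move=> hg hh r s; have -> : 2 * c * d = c * d + c * d by ring.
rewrite mulmx2E; apply: (le_trans (ler_normD _ _)); rewrite !normrM.
by apply: lerD; apply: ler_pM.
Qed.

Lemma scaleE (x : RR) (v : 'cV[RR]_2) r : (x *: v) r 0 = x * v r 0.
Proof. by rewrite mxE. Qed.

Lemma mx_ubound (g : 'M[RR]_2) : exists2 c : RR, 1 <= c & forall r s, `|g r s| <= c.
Proof.
exists (1 + `|g 0 0| + `|g 0 1| + `|g 1 0| + `|g 1 1|).
  by rewrite -!addrA lerDl !addr_ge0.
have := normr_ge0 (g 0 0); have := normr_ge0 (g 0 1); have := normr_ge0 (g 1 0).
have := normr_ge0 (g 1 1) => h1 h2 h3 h4 r s.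
by case: (ord2P r) => ->; case: (ord2P s) => ->; lra.
Qed.

Lemma iterate_conj k (B B' : cocycle k) (Q : 'M[RR]_2) :
  (forall j, B j *m Q = Q *m B' j) ->
  forall u : seq 'I_k, iterate B u *m Q = Q *m iterate B' u.
Proof.
move=> h; elim=> [|j u IH]; first by rewrite /iterate /= mul1mx mulmx1.
by rewrite !iterate_cons -mulmxA h mulmxA IH mulmxA.
Qed.

Section Coordinates.
Variables (P : 'M[RR]_2) (c : RR).
Hypotheses (P_unit : P \in unitmx) (c_ge1 : 1 <= c)
  (hP : forall r s, `|P r s| <= c) (hPi : forall r s, `|(invmx P) r s| <= c).

Lemma nm_basis_le v : nm v <= 2 * c * nm (P *m v).
Proof. by rewrite -{1}[v](mulKmx P_unit); exact: nm_mul_le. Qed.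

(** The basis change multiplies wedge products by [\det P] and norms by factors controlled by [c].
    The free scalar [x] is present because [eminus] is an arbitrary eigenvector, without
    normalization. *)
Lemma pdist_basis (B M : 'M[RR]_2) (w : 'cV[RR]_2) (x lo hi : RR) :
  B *m P = P *m M -> nm w = 1 -> 0 < lo -> lo <= nm (M *m w) -> nm (M *m w) <= hi -> x != 0 ->
  pdist (B *m (x *: (P *m w))) (x *: (P *m w)) * (lo / (4 * c ^+ 2)) <=
    `|\det P| * `|wedge (M *m w) w| /\
  `|\det P| * `|wedge (M *m w) w| <=
    pdist (B *m (x *: (P *m w))) (x *: (P *m w)) * (16 * c ^+ 2 * hi).
Proof.
move=> hBM w1 lo0 hlo hhi x0.
have c0 : 0 < c by exact: lt_le_trans c_ge1.
have -> : B *m (x *: (P *m w)) = x *: (P *m (M *m w)).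
  by rewrite -scalemxAr !mulmxA hBM.
have vZ y u : vnorm (y *: u) = `|y| * vnorm u.
  by rewrite /vnorm !mxE !exprMn -mulrDr sqrtrM ?sqr_ge0// sqrtr_sqr.
pose u1 := P *m (M *m w); pose u2 := P *m w.
have lo1 : lo / (2 * c) <= vnorm u1.
  apply: le_trans (vnorm_ge _); rewrite ler_pdivrMr ?mulr_gt0// mulrC.
  exact: le_trans hlo (nm_basis_le _).
have lo2 : 1 / (2 * c) <= vnorm u2.
  apply: le_trans (vnorm_ge _); rewrite ler_pdivrMr ?mulr_gt0// mulrC -[leLHS]w1.
  exact: nm_basis_le.
have hi1 : vnorm u1 <= 4 * c * hi.
  apply: (le_trans (vnorm_le _)); have h1 := nm_mul_le (M *m w) hP.
  have h2 : 2 * c * nm (M *m w) <= 2 * c * hi by rewrite ler_wpM2l// mulr_ge0// ltW.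
  rewrite /u1; lra.
have hi2 : vnorm u2 <= 4 * c.
  by apply: (le_trans (vnorm_le _)); have := nm_mul_le w hP; rewrite w1 /u2; lra.
have q0 : 0 < lo / (2 * c) by rewrite divr_gt0// mulr_gt0.
have q1 : 0 < 1 / (2 * c) by rewrite divr_gt0// mulr_gt0.
have v1 : 0 < vnorm u1 by exact: lt_le_trans lo1.
have v2 : 0 < vnorm u2 by exact: lt_le_trans lo2.
set D := pdist _ _.
have eD : D * (vnorm u1 * vnorm u2) = `|\det P| * `|wedge (M *m w) w|.
  rewrite -normrM -wedge_mul /D /pdist !vZ !scaleE -/u1 -/u2 /wedge.
  have -> : x * u1 0 0 * (x * u2 1 0) - x * u1 1 0 * (x * u2 0 0) =
     x * x * (u1 0 0 * u2 1 0 - u1 1 0 * u2 0 0) by ring.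
  rewrite !normrM; field; rewrite normr_eq0 x0 !gt_eqF//.
have D0 : 0 <= D by rewrite /D /pdist divr_ge0// mulr_ge0// sqrtr_ge0.
rewrite -eD; split; apply: ler_wpM2l => //.
  have -> : lo / (4 * c ^+ 2) = lo / (2 * c) * (1 / (2 * c)) by field; rewrite gt_eqF.
  by apply: ler_pM => //; exact: ltW.
have -> : 16 * c ^+ 2 * hi = 4 * c * hi * (4 * c) by ring.
by apply: ler_pM => //; exact: ltW.
Qed.

(* The basis [e, f / th], with [f] sheared by [t] from the second basis vector: in it the
   off-diagonal entry moving [f] off its line is divided by [th] and the other one is
   multiplied by [th]. *)
Definition sheared (t th : RR) (M : 'M[RR]_2) : 'M[RR]_2 :=
  mx2 (M 0 0 - t * M 1 0) ((M 0 0 * t + M 0 1 - t * (M 1 0 * t + M 1 1)) / th)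
      (th * M 1 0) (M 1 0 * t + M 1 1).

(** The growth of [sheared] is transported through the basis [P *m S]. Entering the new coordinates
    may shrink a vector by [th / (4 c)]; leaving them costs only [4 c], since the entries of [Si]
    are at most 1. So [ln th] appears once and [ln (4 * c)] twice. *)
Lemma sheared_growth k (p : 'I_k -> RR) (B M : cocycle k) (t th L C : RR) :
  prob_vec p -> (forall j, B j *m P = P *m M j) -> `|t| <= 1 -> 0 < th <= 1 ->
  (forall m v, v != 0 -> ln (nm v) + L * m%:R - C <=
     Ex p m (fun u => ln (nm (iterate (fun j => sheared t th (M j)) u *m v)))) ->
  (forall j v, v != 0 -> B j *m v != 0) ->
  forall m v, v != 0 -> ln (nm v) + ln th + L * m%:R - C - 2 * ln (4 * c) <=
     Ex p m (fun u => ln (nm (iterate B u *m v))).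
Proof.
move=> hp hBM t1 /andP[th0 th1] growth Bn0 m v v0.
have c0 : 0 < c by exact: lt_le_trans c_ge1.
have thn0 : th != 0 by rewrite gt_eqF.
pose S := mx2 1 (t / th) 0 th^-1; pose Si := mx2 1 (- t) 0 th.
have SSi : S *m Si = 1%:M.
  by apply: eq_mx2; rewrite !mulmx2E !mxE /=; field.
have SiS : Si *m S = 1%:M.
  by apply: eq_mx2; rewrite !mulmx2E !mxE /=; field.
have conjS j : M j *m S = S *m sheared t th (M j).
  by apply: eq_mx2; rewrite !mulmx2E !mxE /=; field.
have conj j : B j *m (P *m S) = (P *m S) *m sheared t th (M j).
  by rewrite mulmxA hBM -!mulmxA conjS.
have itc u := iterate_conj conj u.
have nmS x : nm (S *m x) <= 2 / th * nm x.
  apply: nm_mul_le => r s.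
  have i1 : 1 <= th^-1 by rewrite invf_ge1.
  case: (ord2P r) => ->; case: (ord2P s) => ->; rewrite !mxE /= ?normr0 ?normr1//.
  - by rewrite normrM [`|th^-1|]gtr0_norm ?invr_gt0// -[leRHS]mul1r ler_wpM2r// invr_ge0 ltW.
  - by rewrite invr_ge0 ltW.
  - by rewrite gtr0_norm// invr_gt0.
have nmSi x : nm (Si *m x) <= 2 * 1 * nm x.
  apply: nm_mul_le => r s.
  case: (ord2P r) => ->; case: (ord2P s) => ->; rewrite !mxE /= ?normr0 ?normr1// ?normrN//.
  by rewrite gtr0_norm.
pose vt := Si *m (invmx P *m v).
have vE : v = P *m (S *m vt) by rewrite /vt [S *m _]mulmxA SSi mul1mx mulKVmx.
have c4 : 0 < 4 * c by rewrite mulr_gt0.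
have vt_lo : nm v * th <= 4 * c * nm vt.
  have h1 : nm v <= 2 * c * nm (S *m vt) by rewrite {1}vE; exact: nm_mul_le.
  have h2 : th * nm (S *m vt) <= 2 * nm vt.
    have -> : 2 * nm vt = th * (2 / th * nm vt) by field.
    by rewrite ler_wpM2l// ltW.
  have h3 := ler_wpM2r (ltW th0) h1.
  have h4 := ler_wpM2l (ltW c0) h2; lra.
have nv := nm_gt0 v0.
have nvt : 0 < nm vt.
  by have := mulr_gt0 nv th0; have := nm_ge0 vt; nra.
have vt0 : vt != 0 by exact: nm0P.
have itB (u : seq 'I_k) : iterate B u *m v != 0.
  elim: u v v0 {vt vE vt_lo nv nvt vt0} => [|j u IH] v v0; first by rewrite /iterate /= mul1mx.
  by rewrite iterate_cons -mulmxA IH// Bn0.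
have low (u : seq 'I_k) : ln (nm (iterate (fun j => sheared t th (M j)) u *m vt)) - ln (4 * c)
    <= ln (nm (iterate B u *m v)).
  set x := iterate _ u *m vt; set y := iterate B u *m v.
  have e : y = P *m (S *m x).
    by rewrite /y {1}vE (mulmxA P S vt) mulmxA itc -!mulmxA.
  have xy : x = Si *m (invmx P *m y) by rewrite e mulKmx// mulmxA SiS mul1mx.
  have ny : 0 < nm y by apply: nm_gt0; exact: itB.
  have xle : nm x <= 4 * c * nm y.
    rewrite xy; apply: (le_trans (nmSi _)); have := nm_mul_le y hPi; lra.
  have [nx|nx] := ltP 0 (nm x).
    by rewrite lerBlDl -lnM ?posrE// ler_ln ?posrE// mulr_gt0.
  exfalso; move: nx; rewrite leNgt; apply/negP; rewrite negbK.
  apply: nm_gt0; apply: contraTneq ny => x0.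
  by rewrite e x0 !mulmx0 /nm !mxE normr0 maxxx ltxx.
apply: (@le_trans _ _ (Ex p m (fun u =>
    ln (nm (iterate (fun j => sheared t th (M j)) u *m vt)) - ln (4 * c)))); last first.
  by apply: (le_Ex hp) => u _; exact: low.
rewrite Ex_sub Ex_const//; have := growth m vt vt0.
have : ln (nm v * th) <= ln (4 * c * nm vt) by rewrite ler_ln ?posrE ?mulr_gt0.
rewrite lnM ?posrE// [ln (4 * c * nm vt)]lnM ?posrE//.
move: (Ex _ _ _) (ln (nm vt)) (ln (nm v)) (ln th) (ln (4 * c)) => *; lra.
Qed.

End Coordinates.

(** The first basis vector is the given [e], the second is whichever of the two invariant lines is
    not parallel to it; one exists because the lines are transversal. The product [a j * b j] is the
    determinant of [A j]. *)
Lemma diag_coords k (A : cocycle k) (e : 'cV[RR]_2) (a : 'I_k -> RR) :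
  (forall j, inSL (A j)) -> inDiag A -> e != 0 -> (forall j, A j *m e = a j *: e) ->
  exists (P : 'M[RR]_2) (b : 'I_k -> RR),
    [/\ P \in unitmx, forall j, a j * b j = 1 \/ a j * b j = -1 &
        forall j, invmx P *m A j *m P = mx2 (a j) 0 0 (b j)].
Proof.
move=> hA [u [v [[u0 hu] [[v0 hv] uv]]]] e0 he.
have [f [f0 hf ef]] : exists f : 'cV[RR]_2,
    [/\ f != 0, forall j, exists b, A j *m f = b *: f & wedge e f != 0].
  have [eu|eu] := eqVneq (wedge e u) 0; last by exists u.
  have [ev|ev] := eqVneq (wedge e v) 0; last by exists v.
  exfalso; move/negP: uv; apply; apply/eqP.
  have e1 : e 0 0 * (u 0 0 * v 1 0 - u 1 0 * v 0 0) = 0.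
    transitivity (u 0 0 * wedge e v - v 0 0 * wedge e u); first by rewrite /wedge; ring.
    by rewrite eu ev !mulr0 subrr.
  have e2 : e 1 0 * (u 0 0 * v 1 0 - u 1 0 * v 0 0) = 0.
    transitivity (u 1 0 * wedge e v - v 1 0 * wedge e u); first by rewrite /wedge; ring.
    by rewrite eu ev !mulr0 subrr.
  move/eqP: e1; rewrite mulf_eq0 => /orP[/eqP e1|/eqP//].
  move/eqP: e2; rewrite mulf_eq0 => /orP[/eqP e2|/eqP//].
  by move/eqP: e0; case; apply: eq_cV2; rewrite mxE.
have [b hb] := choice hf.
pose P := mx2 (e 0 0) (f 0 0) (e 1 0) (f 1 0).
have detP : \det P = wedge e f by rewrite det2E !mxE /= /wedge; ring.
have uP : P \in unitmx by rewrite unitmxE unitfE detP.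
exists P, b; split => // j.
  have : a j * b j * wedge e f = \det (A j) * wedge e f.
    by rewrite -wedge_mul he hb /wedge !mxE; ring.
  by move/(mulIf ef) => ->; exact: hA.
rewrite -mulmxA; have -> : A j *m P = P *m mx2 (a j) 0 0 (b j).
  have hc0 := congr1 (fun x : 'cV[RR]_2 => x 0 0) (he j).
  have hc1 := congr1 (fun x : 'cV[RR]_2 => x 1 0) (he j).
  have hd0 := congr1 (fun x : 'cV[RR]_2 => x 0 0) (hb j).
  have hd1 := congr1 (fun x : 'cV[RR]_2 => x 1 0) (hb j).
  move: hc0 hc1 hd0 hd1; rewrite /= !mulmx2E !scaleE => hc0 hc1 hd0 hd1.
  apply: eq_mx2; rewrite !mulmx2E !mxE /= ?mulr0 ?addr0 ?add0r.
  - by rewrite hc0 mulrC.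
  - by rewrite hd0 mulrC.
  - by rewrite hc1 mulrC.
  - by rewrite hd1 mulrC.
by rewrite mulKmx.
Qed.

Lemma hyperbolic_conj (B M P : 'M[RR]_2) : P \in unitmx -> B *m P = P *m M ->
  hyperbolic M -> hyperbolic B.
Proof.
move=> uP hBM [x [y [x1 [y1 [[v hv] [w hw]]]]]]; exists x, y.
have conj z u : eigvec M z u -> exists u', eigvec B z u'.
  move=> [u0 hu]; exists (P *m u); split; last by rewrite mulmxA hBM -mulmxA hu -scalemxAr.
  by apply: contra u0 => /eqP h; rewrite -[u](mulKmx uP) h mulmx0.
by split => //; split => //; split; [exact: conj hv | exact: conj hw].
Qed.

(** The first row of the eigenvalue equation is [(M 0 0 - m) w_0 = - M 0 1 w_1], and
    [|M 0 0 - m| >= L / 2] since [|a| >= 1 + L] and [|m| < 1]. The contracting direction is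
    therefore close to the second axis. *)
Lemma contr_dir_slope (M : 'M[RR]_2) w (a d L m : RR) : w != 0 -> M *m w = m *: w ->
  `|m| < 1 -> 0 < L -> 1 + L <= `|a| -> `|M 0 0 - a| <= d -> `|M 0 1| <= d -> 2 * d <= L ->
  w 1 0 != 0 /\ `|w 0 0 / w 1 0| <= 2 / L * d.
Proof.
move=> w0 hw m1 L0 ha h00 h01 dL.
have := congr1 (fun x : 'cV[RR]_2 => x 0 0) hw; rewrite /= mulmx2E scaleE => e.
have {}e : (M 0 0 - m) * w 0 0 = - (M 0 1 * w 1 0) by rewrite mulrBl -e; ring.
have lo : L / 2 <= `|M 0 0 - m|.
  have h1 := ler_normD (a - M 0 0) (M 0 0 - m); have h2 := ler_normD (a - m) m.
  move: h1 h2; rewrite subrK [`|a - M 0 0|]distrC addrA subrK => h1 h2; lra.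
have h1 : L / 2 * `|w 0 0| <= d * `|w 1 0|.
  apply: (@le_trans _ _ (`|M 0 0 - m| * `|w 0 0|)); first by rewrite ler_wpM2r.
  by rewrite -normrM e normrN normrM ler_wpM2r.
have w10 : w 1 0 != 0.
  apply: contra w0 => /eqP e1; apply/eqP/eq_cV2; rewrite mxE //.
  move: h1; rewrite e1 normr0 mulr0 => h1; apply/eqP; rewrite -normr_le0.
  have := normr_ge0 (w 0 0); nra.
split=> //; rewrite normf_div ler_pdivrMr ?normr_gt0//.
have -> : 2 / L * d * `|w 1 0| = 2 / L * (d * `|w 1 0|) by ring.
rewrite -[leLHS](_ : 2 / L * (L / 2 * `|w 0 0|) = _); last by field; rewrite gt_eqF.
by rewrite ler_wpM2l// divr_ge0// ltW.
Qed.

(** Prepares [pdist_basis] for the direction [(t, 1)]. The wedge product computed here is, up to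
    division by [th], the upper-right entry of [sheared], which ties that entry to [rho_minus]. *)
Lemma near_diag_slope (M : 'M[RR]_2) (a b C d t D : RR) :
  1 <= C -> `|a| <= C -> `|b| <= C -> C^-1 <= `|b| -> 2 * d <= (2 * C)^-1 -> d <= 1 ->
  `|M 0 0 - a| <= d -> `|M 1 1 - b| <= d -> `|M 0 1| <= d -> `|M 1 0| <= d ->
  `|t| <= 1 -> `|t| <= D * d ->
  let w := \col_r (if r == 0 then t else 1) in
  [/\ nm w = 1, (2 * C)^-1 <= nm (M *m w), nm (M *m w) <= 2 * (C + 1),
      wedge (M *m w) w = M 0 0 * t + M 0 1 - t * (M 1 0 * t + M 1 1) &
      `|M 0 0 * t + M 0 1 - t * (M 1 0 * t + M 1 1)| <= (1 + (2 * C + 3) * D) * d].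
Proof.
move=> C1 aC bC bV dC d1 h00 h11 h01 h10 t1 tD w.
have d0 : 0 <= d by exact: le_trans (normr_ge0 _) h00.
have n00 : `|M 0 0| <= C + 1 by have := ler_normD (M 0 0 - a) a; rewrite subrK; lra.
have n11 : `|M 1 1| <= C + 1 by have := ler_normD (M 1 1 - b) b; rewrite subrK; lra.
have w1 : nm w = 1 by rewrite /nm !mxE /= normr1; apply/max_idPr.
have m10 : `|M 1 0 * t| <= d by rewrite normrM -[leRHS]mulr1 ler_pM.
have C2 : (2 * C)^-1 = C^-1 / 2 by field; rewrite gt_eqF//; lra.
split => //.
- apply: le_trans (nm_coord _ 1); rewrite mulmx2E !mxE /= mulr1 addrC.
  have := lerB_normD (M 1 1) (M 1 0 * t); have := ler_normD (b - M 1 1) (M 1 1).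
  by rewrite subrK [`|b - _|]distrC; rewrite C2 in dC *; lra.
- have := @nm_mul_le M (C + 1) w; rewrite w1 mulr1; apply => r s.
  by case: (ord2P r) => ->; case: (ord2P s) => ->; rewrite //; lra.
- by rewrite /wedge !mulmx2E !mxE /=; ring.
have h1 : `|M 0 0 * t| <= (C + 1) * (D * d) by rewrite normrM ler_pM.
have h2 : `|t * (M 1 0 * t + M 1 1)| <= (D * d) * (C + 2).
  by rewrite normrM ler_pM//; have := ler_normD (M 1 0 * t) (M 1 1); lra.
have := ler_normB (M 0 0 * t + M 0 1) (t * (M 1 0 * t + M 1 1)).
have := ler_normD (M 0 0 * t) (M 0 1); lra.
Qed.

(** [SigmaH] allows any vector satisfying [eplus]. In diagonal coordinates such a vector has a
    nonzero first coordinate, as otherwise its exponent would be that of [b], namely [- L(A) < 0];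
    hence its eigenvalues are the [a j]. *)
Lemma SigmaH_expanding k (p : 'I_k -> RR) (A : cocycle k) (P : 'M[RR]_2) (a b : 'I_k -> RR) :
  0 < lyap p A -> P \in unitmx -> (forall j, `|a j| * `|b j| = 1) ->
  (forall j, invmx P *m A j *m P = mx2 (a j) 0 0 (b j)) ->
  \sum_j p j * ln `|a j| = lyap p A ->
  forall i, SigmaH p A i -> expR (lyap p A) <= `|a i|.
Proof.
move=> L0 uP nab hDg hL i [e [a' [[e0 [he hL']] hi]]].
pose w := invmx P *m e.
have wn0 : w != 0 by apply: contra e0 => /eqP h; rewrite -[e](mulKVmx uP) -/w h mulmx0.
have hw j : mx2 (a j) 0 0 (b j) *m w = a' j *: w.
  by rewrite -hDg /w -!mulmxA mulKVmx// he -scalemxAr.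
have [w0|w0] := eqVneq (w 0 0) 0.
  exfalso; have w1 : w 1 0 != 0.
    by apply: contra wn0 => /eqP h; apply/eqP/eq_cV2; rewrite [RHS]mxE.
  have ab j : a' j = b j.
    have := congr1 (fun x : 'cV[RR]_2 => x 1 0) (hw j); rewrite /= mulmx2E scaleE.
    rewrite ![mx2 _ _ _ _ _ _]mxE /= mul0r add0r.
    by move/(mulIf w1).
  have : \sum_j p j * ln `|a' j| = - \sum_j p j * ln `|a j|.
    rewrite -sumrN; apply: eq_bigr => j _; rewrite ab -mulrN; congr (_ * _).
    have a0 : `|a j| != 0 by apply: contra_eq_neq (nab j) => ->; rewrite mul0r eq_sym oner_eq0.
    have -> : `|b j| = `|a j|^-1 by apply: (mulfI a0); rewrite nab divff.
    by rewrite lnV// posrE lt_neqAle eq_sym a0 normr_ge0.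
  by rewrite hL hL' => h; move: L0; lra.
have -> : a i = a' i; last by [].
have := congr1 (fun x : 'cV[RR]_2 => x 0 0) (hw i); rewrite /= mulmx2E scaleE.
rewrite ![mx2 _ _ _ _ _ _]mxE /= mul0r addr0.
by move/(mulIf w0).
Qed.

(** The adjugate is the inverse up to sign and has the same entries up to sign and position. *)
Lemma SL_nm_le (g : 'M[RR]_2) (c : RR) v : inSL g -> (forall r s, `|g r s| <= c) ->
  nm v <= 2 * c * nm (g *m v).
Proof.
move=> hg hc; pose g' := mx2 (g 1 1) (- g 0 1) (- g 1 0) (g 0 0).
have e : g' *m (g *m v) = \det g *: v.
  by rewrite mulmxA; apply: eq_cV2; rewrite !mulmx2E scaleE det2E !mxE /=; ring.
have -> : nm v = nm (g' *m (g *m v)).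
  by rewrite e nmZ; case: hg => ->; rewrite ?normrN normr1 mul1r.
apply: nm_mul_le => r s.
by case: (ord2P r) => ->; case: (ord2P s) => ->; rewrite !mxE /= ?normrN.
Qed.

(** Supplies the growth hypothesis of [large_deviations] with a time proportional to
    [log (1 / rho)], the constant depending on [A] and [p] only. The matrix [B i] that attains [rho]
    has upper-right entry zero in the sheared basis, and [uniform_growth] applies there. *)
Lemma growth_time k (p : 'I_k -> RR) (A : cocycle k) (e : 'cV[RR]_2) (a : 'I_k -> RR) :
  prob_vec p -> (forall j, inSL (A j)) -> inDiag A -> 0 < lyap p A -> eplus p A e a ->
  exists2 delta : RR, 0 < delta <= 1 & exists2 C : RR, 1 <= C &
  forall B : cocycle k, (forall j, inSL (B j)) ->
    (forall i r s, `|B i r s - A i r s| < delta) ->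
    (forall i, SigmaH p A i -> hyperbolic (B i)) /\
    (0 < rho_minus p A B -> 1 <= ln ((rho_minus p A B)^-1) /\
      exists m : nat, [/\ (0 < m)%N, m%:R <= C * ln ((rho_minus p A B)^-1) &
        forall v, v != 0 ->
          ln (nm v) + 1 <= Ex p m (fun u => ln (nm (iterate B u *m v)))]).
Proof.
move=> hp hA hD L0 [e0 [he hL]].
have [P [b [uP hab hDg]]] := diag_coords hA hD e0 he.
have nab j : `|a j| * `|b j| = 1 by rewrite -normrM; case: (hab j) => ->; rewrite ?normrN normr1.
have hS := SigmaH_expanding L0 uP nab hDg hL.
move: (lyap p A) L0 hL hS => L L0 hL hS.
have [c [cge1 hP hPi]] : exists c : RR, [/\ 1 <= c, forall r s, `|P r s| <= c &
    forall r s, `|(invmx P) r s| <= c].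
  have [x x1 hx] := mx_ubound P; have [y y1 hy] := mx_ubound (invmx P).
  by exists (x + y); split=> [|r s|r s]; [lra | have := hx r s; lra | have := hy r s; lra].
have [C [C1 aC bC]] : exists C : RR, [/\ 1 <= C, forall j, `|a j| <= C & forall j, `|b j| <= C].
  have [x x1 hx] := fin_ubound a; have [y y1 hy] := fin_ubound b.
  by exists (x + y); split=> [|j|j]; [lra | have := hx j; lra | have := hy j; lra].
have C0 : 0 < C by lra.
have bV j : C^-1 <= `|b j|.
  by rewrite -[leLHS]mul1r ler_pdivrMr// -(nab j) mulrC ler_wpM2l.
have [eta eta0 growth] := uniform_growth hp nab hL L0.
have dP : 0 < `|\det P| by rewrite normr_gt0 -unitfE -unitmxE.
have c0 : 0 < c by lra.
pose lo := (2 * C)^-1; pose hi := 2 * (C + 1).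
have lo0 : 0 < lo by rewrite /lo invr_gt0 mulr_gt0.
have hi0 : 0 < hi by rewrite /hi mulr_gt0//; lra.
pose c1 := lo / (4 * c ^+ 2) / `|\det P|; pose c2 := 16 * c ^+ 2 * hi / `|\det P|.
have cc0 : 0 < c ^+ 2 by rewrite exprn_gt0.
have c10 : 0 < c1 by apply: divr_gt0 => //; apply: divr_gt0 => //; apply: mulr_gt0.
have c20 : 0 < c2 by apply: divr_gt0 => //; apply: mulr_gt0 => //; apply: mulr_gt0.
(* The rescaling factor will be [th = K * rho]. Entries of modulus at most [c2 * rho] become at most
   [eta], and the one of modulus at least [c1 * rho] becomes at least [zeta = c1 / K]. *)
pose K := c2 / eta; have K0 : 0 < K by exact: divr_gt0.
pose zeta := c1 / K; have zeta0 : 0 < zeta by exact: divr_gt0.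
have [eps eps0 [Cg {}growth]] := growth _ zeta0.
pose D := 2 / L; have D0 : 0 < D by exact: divr_gt0.
pose C' := 1 + (2 * C + 3) * D.
have C'0 : 0 < C' by rewrite /C' addr_gt0// mulr_gt0//; lra.
(* The first bound on [rho] ensures [th <= 1], the second [log (1 / rho) >= 1]. *)
pose rho0 := Num.min K^-1 (expR (-1)).
have rho00 : 0 < rho0 by rewrite lt_min invr_gt0 K0 expR_gt0.
have [d d0 [[d1 dL dL2 dC] [deta deps drho]]] : exists2 d : RR, 0 < d &
    [/\ d <= 1, d <= L / 8, d <= L ^+ 2 / (16 * C) & d <= (4 * C + 4)^-1] /\
    [/\ d <= eta / 2, d <= eps & d <= c1 * rho0 / C'].
  exists (Num.min 1 (Num.min (L / 8) (Num.min (L ^+ 2 / (16 * C)) (Num.min (4 * C + 4)^-1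
    (Num.min (eta / 2) (Num.min eps (c1 * rho0 / C'))))))).
    rewrite !lt_min ltr01 eps0 !divr_gt0 ?exprn_gt0 ?mulr_gt0 ?invr_gt0//; lra.
  by do 2!split; rewrite !ge_min lexx ?orbT.
have dL' : 4 * d < L by lra.
have dL2' : 8 * C * d < L ^+ 2.
  have L20 : 0 < L ^+ 2 by rewrite exprn_gt0.
  have C16 : 0 < 16 * C by lra.
  have : d * (16 * C) <= L ^+ 2 by rewrite -ler_pdivlMr.
  lra.
have C4 : 0 < 4 * C + 4 by lra.
have dC4 : d * (4 * C + 4) <= 1 by rewrite -ler_pdivlMr// mul1r.
have dC' : (2 * C + 2) * d < 1 by lra.
have dlo : 2 * d <= (2 * C)^-1.
  by rewrite -[leRHS]mul1r ler_pdivlMr ?mulr_gt0//; lra.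
(* Conjugation by [P] enlarges entries by at most [4 c^2], so the conjugated matrices are within [d]
   of the diagonal ones. *)
pose delta := d / (4 * c ^+ 2).
have cc1 : 1 <= 4 * c ^+ 2 by nra.
have c40 : 0 < 4 * c ^+ 2 by lra.
have delta1 : 0 < delta <= 1.
  by rewrite /delta divr_gt0//= ler_pdivrMr// mul1r; lra.
pose X0 := D * (1 + 2 * `|ln (4 * c)| + `|Cg| + `|ln K|).
have X00 : 0 <= X0 by rewrite /X0 mulr_ge0 ?(ltW D0)// !addr_ge0// mulr_ge0.
exists delta => //; exists (X0 + D + 1); first by lra.
move=> B hB hBA.
pose M j := invmx P *m B j *m P.
have hBM j : B j *m P = P *m M j by rewrite /M -mulmxA mulKVmx.
have MSL j : inSL (M j).
  rewrite /inSL.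
  have dP0 : \det P != 0 by rewrite -normr_gt0.
  have -> : \det (M j) = \det (B j) by rewrite /M !det_mulmx det_inv mulrAC mulVf// mul1r.
  exact: hB.
have hM j r s : `|M j r s - mx2 (a j) 0 0 (b j) r s| <= d.
  have -> : M j r s - mx2 (a j) 0 0 (b j) r s = (invmx P *m (B j - A j) *m P) r s.
    by rewrite mulmxBr mulmxBl hDg !mxE.
  have -> : d = 2 * (2 * c * delta) * c by rewrite /delta; field; rewrite gt_eqF.
  apply: entry_mul_le => // r' s'; apply: entry_mul_le => // r'' s''.
  by rewrite !mxE; apply: ltW; exact: hBA.
have M00 j : `|M j 0 0 - a j| <= d by have := hM j 0 0; rewrite [mx2 _ _ _ _ _ _]mxE.
have M11 j : `|M j 1 1 - b j| <= d by have := hM j 1 1; rewrite [mx2 _ _ _ _ _ _]mxE.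
have M01 j : `|M j 0 1| <= d by have := hM j 0 1; rewrite [mx2 _ _ _ _ _ _]mxE /= subr0.
have M10 j : `|M j 1 0| <= d by have := hM j 1 0; rewrite [mx2 _ _ _ _ _ _]mxE /= subr0.
clearbody M.
have hypB i : SigmaH p A i -> hyperbolic (B i).
  move=> /hS hi'; apply: (hyperbolic_conj uP (hBM i)).
  exact: (@hyperbolic_near_diag _ (a i) (b i) L C d).
split=> // rho_gt0; move: (rho_gt0); rewrite {1}/rho_minus => /bigmax_attained[i /asboolP Si].
rewrite -/(rho_minus p A B); set rho := rho_minus p A B => erho.
have rhop : 0 < rho by [].
have [j0 _ ej0] : exists2 j0 : 'I_k, true & rho = pdist (B j0 *m eminus (B i)) (eminus (B i)).
  by rewrite erho; apply: bigmax_attained; rewrite -erho.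
have rho_ub j : pdist (B j *m eminus (B i)) (eminus (B i)) <= rho.
  by rewrite erho; exact: (le_bigmax_cond 0 (fun j => pdist (B j *m eminus (B i)) (eminus (B i)))).
(* Hyperbolicity of [B i] makes [eminus] a genuine contracting eigenvector instead of its default
   value 0. *)
have [m [m1 [f0 hf]]] : contr_dir (B i) (eminus (B i)).
  have [x [y [_ [y1 [_ [v hv]]]]]] := hypB i Si.
  by apply: (@xgetPex _ 0 [set v | contr_dir (B i) v]%classic); exists v, y.
move: (eminus (B i)) ej0 rho_ub f0 hf => f ej0 rho_ub f0 hf.
pose w' := invmx P *m f.
have w'0 : w' != 0 by apply: contra f0 => /eqP h; rewrite -[f](mulKVmx uP) -/w' h mulmx0.
have hw' : M i *m w' = m *: w'.
  apply: (can_inj (mulKmx uP)); rewrite mulmxA -hBM -mulmxA /w' -scalemxAr !mulKVmx//.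
have aiL : 1 + L <= `|a i| by apply: le_trans (hS i Si); exact: expR_ge1Dx.
have [w1 tD] := contr_dir_slope w'0 hw' m1 L0 aiL (M00 i) (M01 i) ltac:(lra).
set t := w' 0 0 / w' 1 0 in tD.
have t1 : `|t| <= 1.
  apply: (le_trans tD); rewrite mulrAC ler_pdivrMr//; lra.
pose w : 'cV[RR]_2 := \col_r (if r == 0 then t else 1).
have fE : f = w' 1 0 *: (P *m w).
  rewrite scalemxAr; have -> : w' 1 0 *: w = w'; last by rewrite mulKVmx.
  by apply: eq_cV2; rewrite scaleE [w _ _]mxE /= ?mulr1// /t mulrC divfK.
have slope j :=
  near_diag_slope C1 (aC j) (bC j) (bV j) dlo d1 (M00 j) (M11 j) (M01 j) (M10 j) t1 tD.
pose beta j := M j 0 0 * t + M j 0 1 - t * (M j 1 0 * t + M j 1 1).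
have pd j : pdist (B j *m f) f * c1 <= `|beta j| /\ `|beta j| <= pdist (B j *m f) f * c2.
  have [n1 n2 n3 n4 _] := slope j.
  have [h1 h2] := pdist_basis uP cge1 hP hPi (hBM j) n1 lo0 n2 n3 w1.
  move: h1 h2; rewrite -/w -fE n4 -/(beta j) => h1 h2.
  have e1 x : x * c1 = x * (lo / (4 * c ^+ 2)) / `|\det P| by rewrite /c1 mulrA.
  have e2 x : x * c2 = x * (16 * c ^+ 2 * hi) / `|\det P| by rewrite /c2 mulrA.
  by rewrite e1 e2 ler_pdivrMr// ler_pdivlMr// ![`|beta j| * _]mulrC.
have beta_i : beta i = 0.
  have [_ _ _ n4 _] := slope i; rewrite /beta -n4 -/w.
  have -> : M i *m w = m *: w.
    have -> : w = (w' 1 0)^-1 *: w'.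
      apply: eq_cV2; rewrite scaleE [w _ _]mxE /=; first by rewrite /t mulrC.
      by rewrite mulVf.
    by rewrite -scalemxAr hw' !scalerA mulrC.
  by rewrite /wedge !scaleE; ring.
have beta_ub j : `|beta j| <= c2 * rho.
  have [_ h] := pd j; apply: (le_trans h); rewrite mulrC; apply: ler_wpM2l; first exact: ltW.
  exact: rho_ub.
have beta_lb : c1 * rho <= `|beta j0| by have [h _] := pd j0; rewrite mulrC ej0.
have rho_le : rho <= rho0.
  rewrite -(ler_pM2l c10); apply: (le_trans beta_lb).
  have [_ _ _ _ h] := slope j0; apply: (le_trans h); rewrite -/C'.
  by move: drho; rewrite ler_pdivlMr// mulrC.
move: rho_le; rewrite le_min => /andP[rhoK rhoe].
have lam1 : 1 <= ln rho^-1.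
  by rewrite lnV ?posrE// lerNr -[leRHS]expRK ler_ln ?posrE// expR_gt0.
split => //.
pose th := K * rho.
have th0 : 0 < th by exact: mulr_gt0.
have th1 : th <= 1 by move: rhoK; rewrite -[leRHS]mul1r ler_pdivlMr// mulrC.
have eK : c2 / K = eta by rewrite /K; field; rewrite !gt_eqF.
have entry00 j : sheared t th (M j) 0 0 = M j 0 0 - t * M j 1 0 by rewrite mxE.
have entry01 j : sheared t th (M j) 0 1 = beta j / th by rewrite mxE.
have entry10 j : sheared t th (M j) 1 0 = th * M j 1 0 by rewrite mxE.
have entry11 j : sheared t th (M j) 1 1 = M j 1 0 * t + M j 1 1 by rewrite mxE.
have tM j : `|t * M j 1 0| <= d.
  by rewrite normrM -[leRHS]mul1r; apply: ler_pM.
have de : d + d <= eta by lra.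
have gB : forall m v, v != 0 -> ln (nm v) + L / 2 * m%:R - Cg <=
    Ex p m (fun u => ln (nm (iterate (fun j => sheared t th (M j)) u *m v))).
  apply: (growth _ i j0) => //; first exact: hS.
  - by rewrite entry01 beta_i mul0r.
  - rewrite entry01 normf_div (gtr0_norm th0) ler_pdivlMr//.
    have -> : zeta * th = c1 * rho by rewrite /zeta /th mulrA divfK// gt_eqF.
    exact: beta_lb.
  - move=> j; rewrite entry00 addrAC; apply: (le_trans (ler_normB _ _)).
    by apply: le_trans de; apply: lerD.
  - move=> j; rewrite entry11 -addrA [M j 1 0 * t]mulrC; apply: (le_trans (ler_normD _ _)).
    by apply: le_trans de; apply: lerD.
  - move=> j; rewrite entry01 normf_div (gtr0_norm th0) ler_pdivrMr// -eK.
    have -> : c2 / K * th = c2 * rho by rewrite /th mulrA divfK// gt_eqF.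
    exact: beta_ub.
  - move=> j; rewrite entry10 normrM (gtr0_norm th0); apply: le_trans deps.
    by rewrite -[leRHS]mul1r; apply: ler_pM => //; exact: ltW.
have Bn0 j v : v != 0 -> B j *m v != 0.
  move=> v0; apply: contra v0 => /eqP h; have [x x1 hx] := mx_ubound (B j).
  have := SL_nm_le v (hB j) hx; rewrite h => h'; apply: contraLR h' => /nm_gt0 v0.
  by rewrite -ltNge /nm !mxE normr0 maxxx mulr0.
have th01 : 0 < th <= 1 by rewrite th0 th1.
have gr := sheared_growth uP cge1 hP hPi hp hBM t1 th01 gB Bn0.
(* Here [L / 2 * Y] equals [1 + 2 |ln (4 c)| + |Cg| + |ln K| + lam]. This covers all losses in [gr],
   where [ln th = ln K - lam], and leaves the required gain 1. *)
pose lam := ln rho^-1; pose Y := X0 + D * lam.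
have Y0 : 0 <= Y.
  apply: addr_ge0 => //; apply: mulr_ge0; [exact: ltW | exact: le_trans lam1].
exists (Num.truncn Y).+1; split => //.
  have : (Num.truncn Y)%:R <= Y by rewrite truncn_le.
  rewrite -natr1 -/lam; have : X0 <= X0 * lam by rewrite -[leLHS]mulr1 ler_wpM2l.
  move: lam1; rewrite -/lam /Y; lra.
move=> v v0; apply: le_trans (gr _ _ v0).
have hm : Y <= (Num.truncn Y).+1%:R by apply: ltW; exact: truncnS_gt.
have hLm : L / 2 * Y <= L / 2 * (Num.truncn Y).+1%:R.
  by apply: ler_wpM2l => //; apply: divr_ge0 => //; exact: ltW.
have hLY : L / 2 * Y = 1 + 2 * `|ln (4 * c)| + `|Cg| + `|ln K| + lam.
  by rewrite /Y /X0 /D; field; rewrite gt_eqF.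
have lth : ln th = ln K - lam by rewrite /th lnM ?posrE// /lam lnV ?posrE// opprK.
have n1 := ler_norm (ln (4 * c)); have n2 := ler_norm Cg; have n3 := ler_norm (- ln K).
move: hLm; rewrite hLY lth; rewrite normrN in n3.
move: (L / 2 * _) (ln (nm v)) n1 n2 n3 => x y n1 n2 n3 h; lra.
Qed.

Theorem theorem5p1 (k : nat) (p : 'I_k -> RR) (A : cocycle k) :
  prob_vec p -> (forall i, inSL (A i)) -> inDiag A -> 0 < lyap p A ->
  exists delta : RR, 0 < delta /\ exists c : RR, 0 < c /\
    forall B : cocycle k, (forall i, inSL (B i)) ->
      (forall i r s, `|B i r s - A i r s| < delta) ->
      (forall i, SigmaH p A i -> hyperbolic (B i)) /\
      (0 < rho_minus p A B ->
        forall n : nat, (0 < n)%N ->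
          (c^-1 * ln ((rho_minus p A B)^-1)) ^+ 54 <= n%:R ->
          probn p (fun w : n.-tuple 'I_k =>
            n%:R `^ (- 6^-1) < `|(n%:R)^-1 * ln (opnorm (iterate B w)) - lyap p B|)
          < expR (- (n%:R `^ (6^-1)))).
Proof.
move=> hp hA hD L0.
(* If no vector satisfies [eplus], then [SigmaH] is empty and [rho_minus] is 0, so both conclusions
   hold vacuously. *)
have [[e [a ea]]|none] := pselect (exists e a, eplus p A e a); last first.
  have noS i : ~ SigmaH p A i by case=> e [a [h _]]; apply: none; exists e, a.
  exists 1; split=> //; exists 1; split=> // B _ _; split=> [i /noS//|].
  by rewrite /rho_minus big_pred0 ?ltxx// => i; apply/negbTE/asboolPn/noS.
have [delta /andP[d0 d1] [C C1 H]] := growth_time hp hA hD L0 ea.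
have [cA cA1 hcA] := fin_ubound
  (fun j => `|A j 0 0| + `|A j 0 1| + `|A j 1 0| + `|A j 1 1|).
pose kap := expR 1 + 2 * (cA + 1); pose l := ln kap.
(* With [m <= C lam], [lam = log (1 / rho)], the constant of [large_deviations] is at most
   [C4 lam^3], so the threshold for [z] is at most [2 C4^2 lam^6 <= c^-1 lam^6]. *)
pose C4 := 32 * kap ^+ 2 * l ^+ 2 * C ^+ 3 + 2 * l; pose c := (2 * C4 ^+ 2 + 1)^-1.
have c0 : 0 < c by rewrite invr_gt0; have := sqr_ge0 C4; lra.
exists delta; split=> //; exists c; split=> // B hB hBA.
have [hyp grow] := H B hB hBA; split=> // /grow[lam1 [m [m0 mC gm]]] n n0.
move: (ln _) lam1 mC => lam lam1 mC hn.
have e1 : 0 < expR 1 :> RR by exact: expR_gt0.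
have kap1 : 2 * (cA + 1) <= kap by rewrite /kap; lra.
have Bent j r s : `|B j r s| <= cA + 1.
  have h1 : `|A j r s| <= cA.
    apply: le_trans (le_trans (ler_norm _) (hcA j)).
    have := normr_ge0 (A j 0 0); have := normr_ge0 (A j 0 1).
    have := normr_ge0 (A j 1 0); have := normr_ge0 (A j 1 1) => x1 x2 x3 x4.
    by case: (ord2P r) => ->; case: (ord2P s) => ->; lra.
  have := ler_normD (B j r s - A j r s) (A j r s); rewrite subrK.
  by have := hBA j r s; lra.
pose z := (n%:R : RR) `^ 6^-1.
have n0' : 0 < n%:R :> RR by rewrite ltr0n.
have z0 : 0 < z by exact: powR_gt0.
have z6 : z ^+ 6 = n%:R.
  by rewrite -powR_mulrn ?(ltW z0)// /z -powRrM mulVf// powRr1// ltW.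
rewrite powRN -/z; apply: (@large_deviations k p B kap m) => //.
- by rewrite /kap; lra.
- move=> j v; apply: (le_trans (nm_mul_le v (Bent j))).
  by rewrite ler_wpM2r// nm_ge0.
- move=> j v; apply: (le_trans (SL_nm_le v (hB j) (Bent j))).
  by rewrite ler_wpM2r// nm_ge0.
rewrite -/l.
have l0 : 0 <= l by apply: ln_ge0; rewrite /kap; lra.
have lam30 : 1 <= lam ^+ 3 by rewrite exprn_ege1.
have m3 : m%:R ^+ 3 <= C ^+ 3 * lam ^+ 3.
  by rewrite -exprMn lerXn2r ?nnegrE// mulr_ge0//; lra.
have K0 : 0 <= 32 * kap ^+ 2 * l ^+ 2 by apply: mulr_ge0; [apply: mulr_ge0 => // |]; exact: sqr_ge0.
have Dle : 32 * kap ^+ 2 * l ^+ 2 * m%:R ^+ 3 + 2 * l <= C4 * lam ^+ 3.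
  have h1 := ler_wpM2l K0 m3; have h2 := ler_wpM2l l0 lam30.
  by rewrite /C4; lra.
have Dge : 0 <= 32 * kap ^+ 2 * l ^+ 2 * m%:R ^+ 3 + 2 * l.
  by apply: addr_ge0; [apply: mulr_ge0 => //; exact: exprn_ge0 | exact: mulr_ge0].
have D2 : (32 * kap ^+ 2 * l ^+ 2 * m%:R ^+ 3 + 2 * l) ^+ 2 <= C4 ^+ 2 * lam ^+ 6.
  have -> : C4 ^+ 2 * lam ^+ 6 = (C4 * lam ^+ 3) ^+ 2 by ring.
  by rewrite lerXn2r ?nnegrE//; exact: le_trans Dge Dle.
have cV : c^-1 = 2 * C4 ^+ 2 + 1 by rewrite /c invrK.
have cV1 : 1 <= c^-1 by rewrite cV; have := sqr_ge0 C4; lra.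
(* The exponent 54 is 6 times 9: taking sixth roots leaves a ninth power, which dominates
   [c^-1 lam^6] because [c^-1] and [lam] are at least 1. *)
have zW : (c^-1 * lam) ^+ 9 <= z.
  have W0 : 0 <= c^-1 * lam by apply: mulr_ge0; lra.
  rewrite -(@ler_pXn2r _ 6)// ?nnegrE ?exprn_ge0 ?(ltW z0)//.
  by rewrite z6 -exprM.
apply: le_trans zW; rewrite exprMn.
apply: (@le_trans _ _ (c^-1 * lam ^+ 6)).
  rewrite cV; have : 0 <= lam ^+ 6 by rewrite exprn_ge0//; lra.
  move: D2; lra.
have l6 : 0 <= lam ^+ 6 by rewrite exprn_ge0//; lra.
apply: ler_pM => //; first by lra.
- by rewrite -[leLHS]expr1 ler_weXn2l.
- by rewrite ler_weXn2l.
Qed.
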